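(* Let $p$ be a complex polynomial belonging to one of the following classes: (i) polynomials having exactly two distinct roots; (ii) unicritical polynomials, i.e. polynomials of the form $p(z)=(z-\alpha)^n+\beta$ with $\alpha,\beta\in\mathbb{C}$, $\beta\neq 0$, $n\ge 2$; (iii) polynomials of the form $p(z)=(az+b)^m\big[(az+b)^n+c\big]$, where $a,b,c\in\mathbb{C}$, $a\neq 0$, $c\neq 0$, and $m,n\in\mathbb{N}$ with $n\ge 2$. Then the relaxed Newton's method is $h$-convergent for $p$: for every admissible relaxation parameter $h$ (that is, every $h\in\mathbb{C}$ with $|h-\mu|<\mu$, where $\mu$ is the least multiplicity among the roots of $p$), the Fatou set of $N_{h,p}$ consists precisely of the union of the basins of attraction of the roots of $p$.
   Context: For a complex polynomial $p$ with at least two distinct roots and $h\in\mathbb{C}\setminus\{0\}$, the relaxed Newton map is the rational map $N_{h,p}(z)=z-h\,\frac{p(z)}{p'(z)}$ on the Riemann sphere. A root of $p$ of multiplicity $\mu_0$ is a fixed point of $N_{h,p}$ with multiplier $1-h/\mu_0$; the relaxation parameter is called admissible if every root is an attracting fixed point, i.e. $|h-\mu|<\mu$ where $\mu$ is the least root multiplicity. For an attracting fixed point $z_0$, its basin is $\{z:\lim_{k\to\infty}N_{h,p}^k(z)=z_0\}$. The method is called convergent for $p$ (and parameter $h$) if the Fatou set of $N_{h,p}$ equals the union of the basins of the roots of $p$; it is $h$-convergent if it is convergent for every admissible $h$. *)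

(* Defs.v *)
From HB Require Import structures.
From mathcomp Require Import all_boot all_order all_algebra.
From mathcomp Require Import complex.
From mathcomp Require Import reals.

Set Implicit Arguments.
Unset Strict Implicit.
Unset Printing Implicit Defensive.

Import Order.TTheory GRing.Theory Num.Theory.
Local Open Scope ring_scope.

Section RelaxedNewton.
Variable R : realType.
Local Notation C := R[i].

Definition cmod (z : C) : R := ComplexField.Normc.normc z.

(* The Riemann sphere: [Some z] is the finite point z, [None] is infinity. *)
Definition sphere := option C.

Definition chord (z w : sphere) : R :=
  match z, w with
  | Some x, Some y =>
      2 * cmod (x - y) /
        (Num.sqrt (1 + cmod x ^+ 2) * Num.sqrt (1 + cmod y ^+ 2))
  | Some x, None | None, Some x => 2 / Num.sqrt (1 + cmod x ^+ 2)
  | None, None => 0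
  end.

Definition ratmap (P Q : {poly C}) (z : sphere) : sphere :=
  let g := gcdp P Q in
  let P1 := P %/ g in
  let Q1 := Q %/ g in
  match z with
  | Some x => if Q1.[x] == 0 then None else Some (P1.[x] / Q1.[x])
  | None =>
      if (size Q1 < size P1)%N then None
      else if size P1 == size Q1 then Some (lead_coef P1 / lead_coef Q1)
      else Some 0
  end.

(* relaxed Newton map N_{h,p}(z) = z - h p(z)/p'(z) = (z p' - h p)/p' *)
Definition relaxed_newton (h : C) (p : {poly C}) : sphere -> sphere :=
  ratmap ('X * p^`() - h *: p) p^`().

Definition iter_equicont (f : sphere -> sphere) (w : sphere) : Prop :=
  forall e : R, 0 < e -> exists2 d : R, 0 < d &
    forall (k : nat) (u : sphere), chord w u < d ->
      chord (iter k f w) (iter k f u) < e.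

(* Fatou set (Beardon's definition): the points having a neighbourhood on
   which the family of iterates is equicontinuous. *)
Definition fatou (f : sphere -> sphere) (z : sphere) : Prop :=
  exists2 r : R, 0 < r &
    forall w : sphere, chord z w < r -> iter_equicont f w.

Definition basin (f : sphere -> sphere) (z0 : C) (z : sphere) : Prop :=
  forall e : R, 0 < e -> exists K : nat,
    forall k : nat, (K <= k)%N -> chord (iter k f z) (Some z0) < e.

Definition admissible (p : {poly C}) (h : C) : Prop :=
  exists mu : nat,
    [/\ exists2 z, root p z & mup z p = mu,
        forall z, root p z -> (mu <= mup z p)%N
      & `|h - mu%:R| < mu%:R].

Definition newton_convergent (p : {poly C}) (h : C) : Prop :=
  forall z : sphere,
    fatou (relaxed_newton h p) z <->
    exists2 z0 : C, root p z0 & basin (relaxed_newton h p) z0 z.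

Definition h_convergent (p : {poly C}) : Prop :=
  forall h : C, admissible p h -> newton_convergent p h.

Definition two_roots (p : {poly C}) : Prop :=
  p != 0 /\ exists a b : C, a != b /\ forall z, root p z = (z == a) || (z == b).

Definition unicritical (p : {poly C}) : Prop :=
  exists (alpha beta : C) (n : nat),
    [/\ beta != 0, (2 <= n)%N & p = ('X - alpha%:P) ^+ n + beta%:P].

Definition class_iii (p : {poly C}) : Prop :=
  exists (a b c : C) (m n : nat),
    [/\ a != 0, c != 0, (2 <= n)%N &
        p = (a *: 'X + b%:P) ^+ m * ((a *: 'X + b%:P) ^+ n + c%:P)].

End RelaxedNewton.

(* Main.v *)
Require Import Defs.
From HB Require Import structures.
From mathcomp Require Import all_boot all_order all_algebra.
From mathcomp Require Import complex.
From mathcomp Require Import boolp classical_sets reals topology normedtype sequences.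
From mathcomp Require Import ring lra zify.
Set Implicit Arguments.
Unset Strict Implicit.
Unset Printing Implicit Defensive.
Import Order.TTheory GRing.Theory Num.Theory.
Import numFieldNormedType.Exports.
Local Open Scope ring_scope.

(** Let [f] be the relaxed Newton map. It fixes infinity, which is repelling, and
    every root is attracting.

    A composition [F] of rational maps fixing infinity, all of whose preimages of a
    disc [B(y0, r)] are noncritical and omit a disc [B(z1, e)], has inverse branches
    on [B(y0, r)], and the maximum principle for the rational function
    [(x - x0) / ((x - z1) (F x - y0))] along such a branch bounds [F'(x0)] from below.
    Applied to the iterates of [f] at a root it shows that each basin contains a
    critical point. For the three classes the critical points are governed by an
    equation of degree at most two (in [z], or in [(a z + b) ^ n], the map commuting
    with the rotations of order [n]); hence all of them lie in the basins.

    Suppose now that [x] is a Fatou point outside the basins. Its orbit never hits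
    infinity and returns infinitely often to a fixed disc. Equicontinuity bounds the
    derivatives of the iterates at [x] along these returns. On the other hand the
    basins contain a bounded neighbourhood of the finite part of the postcritical
    set which [f] maps strictly into itself; the lower bound above survives if, at
    each return, [f] is composed with a fixed contraction centred at the current
    orbit point, so the derivatives of the iterates grow exponentially with the
    number of returns: a contradiction. *)

(** * Modulus and strict derivatives *)

(** The only analytic input is the maximum principle for a quotient of polynomials, used along the
    identity or along a continuous open section of a rational map. Hence inverse branches need not
    be known to be holomorphic, and a composition is folded into a single pair of polynomials.

    The lower bound on a derivative replaces a distortion theorem. In the quotient used, the zero of
    [F x - y0] at [x0] cancels, leaving the value [1 / ((x0 - z1) F'(x0))]; the omitted disc keeps
    [x - z1] away from 0, which bounds the quotient where [|F x - y0| = r]. This bound is a mere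
    constant, compatible with the upper bound given by equicontinuity. The contractions break the
    tie, and the margin with which a trapping set is mapped into itself pays for them.

    Admissibility enters through the discs [|h - n| < n], which grow with [n]: all multipliers
    [1 - h / n] at roots have modulus below 1, and so does the factor [1 - h / deg p] by which the
    map multiplies large points. Two distinct roots force [deg p >= 2 mu], so [h] differs from
    [deg p]; this keeps the leading coefficient of the critical equation nonzero. *)

Section Modulus.
Variable R : realType.
Local Notation C := R[i].
Implicit Types (x y z u v : C).

Lemma cmodE z : (cmod z)%:C%C = `|z|.
Proof. by []. Qed.

Lemma cmod_ge0 z : 0 <= cmod z.
Proof. by case: z => a b; rewrite /cmod /= sqrtr_ge0. Qed.

Lemma cmod0 : cmod (0 : C) = 0.
Proof. exact: ComplexField.Normc.normc0. Qed.

Lemma cmod1 : cmod (1 : C) = 1.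
Proof. exact: ComplexField.Normc.normc1. Qed.

Lemma cmodM x y : cmod (x * y) = cmod x * cmod y.
Proof. exact: ComplexField.Normc.normcM. Qed.

Lemma cmodV x : cmod x^-1 = (cmod x)^-1.
Proof. exact: ComplexField.Normc.normcV. Qed.

Lemma cmodN x : cmod (- x) = cmod x.
Proof. exact: (@normcN R x). Qed.

Lemma cmodD x y : cmod (x + y) <= cmod x + cmod y.
Proof. exact: (@le_normcD R x y). Qed.

Lemma cmodX x n : cmod (x ^+ n) = cmod x ^+ n.
Proof. by elim: n => [|n IH]; rewrite ?expr0 ?cmod1 // !exprS cmodM IH. Qed.

Lemma cmod_eq0 x : (cmod x == 0) = (x == 0).
Proof.
apply/eqP/eqP => [|->]; last exact: cmod0.
exact: ComplexField.Normc.eq0_normc.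
Qed.

Lemma cmod_gt0 x : (0 < cmod x) = (x != 0).
Proof. by rewrite lt0r cmod_ge0 andbT cmod_eq0. Qed.

Lemma cmodC x y : cmod (x - y) = cmod (y - x).
Proof. by rewrite -cmodN opprB. Qed.

Lemma cmod_tri z x y : cmod (x - y) <= cmod (x - z) + cmod (z - y).
Proof. by apply: le_trans (cmodD _ _); rewrite addrA subrK. Qed.

Lemma cmodB_ge x y : cmod x - cmod y <= cmod (x - y).
Proof. by rewrite lerBlDr; apply: le_trans (cmodD _ _); rewrite subrK. Qed.

Lemma cmod_real (a : R) : cmod a%:C%C = `|a|.
Proof. by rewrite /cmod /= expr0n /= addr0 sqrtr_sqr. Qed.

Lemma cmod_nat n : cmod (n%:R : C) = n%:R.
Proof. by rewrite -(rmorph_nat (@real_complex R)) cmod_real normr_nat. Qed.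

Lemma cmod_sum (I : Type) (r : seq I) (F : I -> C) :
  cmod (\sum_(i <- r) F i) <= \sum_(i <- r) cmod (F i).
Proof.
elim: r => [|i r IH]; first by rewrite !big_nil cmod0.
by rewrite !big_cons; apply: le_trans (cmodD _ _) _; rewrite lerD2l.
Qed.

Lemma cmod_re_im (a b : R) : cmod (a +i* b)%C <= `|a| + `|b|.
Proof.
rewrite /cmod /= -[leRHS]ger0_norm ?addr_ge0 // -sqrtr_sqr.
apply: ler_wsqrtr; rewrite sqrrD !real_normK ?num_real // addrAC lerDl.
by rewrite mulrn_wge0 // mulr_ge0.
Qed.

Lemma norm_re_le z : `|complex.Re z| <= cmod z.
Proof. by rewrite -lecR; exact: normc_ge_Re. Qed.

Lemma norm_im_le z : `|complex.Im z| <= cmod z.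
Proof.
case: z => a b; rewrite /cmod /= -sqrtr_sqr.
by apply: ler_wsqrtr; rewrite lerDr sqr_ge0.
Qed.

(** The real parts converge along a subsequence [f1], the imaginary parts along a further
    subsequence indexed by [f2]. *)
Lemma bounded_cluster_point (u : nat -> C) (M : R) :
  (forall n, cmod (u n) <= M) ->
  exists l : C, forall (e : R) (N : nat), 0 < e ->
    exists2 n, (N <= n)%N & cmod (u n - l) < e.
Proof.
move=> uM.
have bnd (g : C -> R) : (forall z, `|g z| <= cmod z) -> forall v : nat -> nat,
    bounded_fun (fun n => g (u (v n))).
  move=> gle v; exists M; split; first exact: num_real.
  move=> K MK n _ /=; apply: le_trans (gle _) _.
  by apply: le_trans (uM _) _; exact: ltW.
have [f1 f1i /cvg_ex[/= a ca]] :=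
  bolzano_weierstrass (bnd _ norm_re_le id).
have [f2 f2i /cvg_ex[/= b cb]] :=
  bolzano_weierstrass (bnd _ norm_im_le f1).
have incr_ge f : increasing_seq f -> forall n, (n <= f n)%N.
  move=> fi; elim=> // n IH; apply: leq_ltn_trans IH _.
  by rewrite ltnNge; have := fi n.+1 n; rewrite !leEnat ltnn => ->.
exists (a +i* b)%C => e N e0.
have e2 : 0 < e / 2 by rewrite divr_gt0.
move/cvgrPdist_lt: ca => /(_ _ e2) [N1 _ H1].
move/cvgrPdist_lt: cb => /(_ _ e2) [N2 _ H2].
pose k := maxn N (maxn N1 N2).
have kf2 := incr_ge _ f2i k.
exists (f1 (f2 k)).
  apply: leq_trans (incr_ge _ f1i _); apply: leq_trans kf2.
  by rewrite /k leq_max leqnn.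
have h1 : `|a - complex.Re (u (f1 (f2 k)))| < e / 2.
  by apply: H1 => /=; apply: leq_trans kf2; rewrite /k !leq_max leqnn orbT.
have h2 : `|b - complex.Im (u (f1 (f2 k)))| < e / 2.
  by apply: H2 => /=; rewrite /k !leq_max leqnn !orbT.
rewrite cmodC; case: (u _) h1 h2 => c d /= h1 h2.
apply: le_lt_trans (cmod_re_im _ _) _.
by rewrite [ltRHS](splitr e) ltrD.
Qed.

End Modulus.

(** * Strict complex derivatives of polynomials and their quotients *)

Section StrictDerivative.
Variable R : realType.
Local Notation C := R[i].
Implicit Types (x y z u v D : C) (f g : C -> C).

Definition ccont f x := forall e : R, 0 < e -> exists2 d : R, 0 < d &
  forall u, cmod (u - x) < d -> cmod (f u - f x) < e.

(** Both points move: with this strict form a nonzero derivative gives local injectivity at once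
    ([sderiv_inj]). *)
Definition sderiv f x D := forall e : R, 0 < e -> exists2 d : R, 0 < d &
  forall u v, cmod (u - x) < d -> cmod (v - x) < d ->
    cmod (f u - f v - D * (u - v)) <= e * cmod (u - v).

Lemma small_factor (K e : R) : 0 <= K -> 0 < e ->
  exists a : R, [/\ 0 < a, a <= 1 & a * K <= e].
Proof.
move=> K0 e0; have K1 : 0 < K + 1 by lra.
exists (Num.min 1 (e / (K + 1))); split.
- by rewrite lt_min ltr01 divr_gt0.
- by rewrite ge_min lexx.
- apply: (@le_trans _ _ (e / (K + 1) * (K + 1))).
    apply: ler_pM => //; first by rewrite le_min ler01 divr_ge0 ?ltW.
      by rewrite ge_min lexx orbT.
    by rewrite lerDl.
  by rewrite divfK // gt_eqF.
Qed.

Lemma min2_gt0 (a b : R) : 0 < a -> 0 < b ->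
  exists d : R, [/\ 0 < d, d <= a & d <= b].
Proof.
move=> a0 b0; exists (Num.min a b).
by rewrite lt_min a0 b0 !ge_min !lexx orbT.
Qed.

Lemma sderiv_lip f x D : sderiv f x D -> exists2 d : R, 0 < d &
  forall u v, cmod (u - x) < d -> cmod (v - x) < d ->
    cmod (f u - f v) <= (cmod D + 1) * cmod (u - v).
Proof.
move=> /(_ 1 ltr01)[d d0 H]; exists d => // u v ud vd.
have := H u v ud vd; have := cmodB_ge (f u - f v) (D * (u - v)).
rewrite cmodM; lra.
Qed.

Lemma sderiv_cont f x D : sderiv f x D -> ccont f x.
Proof.
move=> /sderiv_lip[d d0 H] e e0.
have K0 : 0 <= cmod D + 1 by have := cmod_ge0 D; lra.
have e2 : 0 < e / 2 by lra.
have [a [a0 _ aK]] := small_factor K0 e2.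
have [d' [d'0 d'd d'a]] := min2_gt0 d0 a0.
exists d' => // u ux.
have := H u x (lt_le_trans ux d'd); rewrite subrr cmod0 => /(_ d0) h.
apply: le_lt_trans h _.
have : (cmod D + 1) * cmod (u - x) <= (cmod D + 1) * a.
  by apply: ler_wpM2l => //; apply: ltW; exact: lt_le_trans d'a.
lra.
Qed.

Lemma sderiv_const c x : sderiv (fun=> c) x 0.
Proof.
move=> e e0; exists 1 => // u v _ _.
by rewrite subrr mul0r subrr cmod0 mulr_ge0 ?cmod_ge0 // ltW.
Qed.

Lemma sderiv_id x : sderiv id x 1.
Proof.
move=> e e0; exists 1 => // u v _ _.
by rewrite mul1r subrr cmod0 mulr_ge0 ?cmod_ge0 // ltW.
Qed.

Lemma sderivD f g x D E : sderiv f x D -> sderiv g x E ->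
  sderiv (fun z => f z + g z) x (D + E).
Proof.
move=> Hf Hg e e0; have e2 : 0 < e / 2 by lra.
have [d1 d10 H1] := Hf _ e2; have [d2 d20 H2] := Hg _ e2.
have [d [d0 dd1 dd2]] := min2_gt0 d10 d20.
exists d => // u v ud vd.
have h1 := H1 u v (lt_le_trans ud dd1) (lt_le_trans vd dd1).
have h2 := H2 u v (lt_le_trans ud dd2) (lt_le_trans vd dd2).
have -> : f u + g u - (f v + g v) - (D + E) * (u - v) =
  (f u - f v - D * (u - v)) + (g u - g v - E * (u - v)) by ring.
apply: le_trans (cmodD _ _) _; lra.
Qed.

Lemma sderivM f g x D E : sderiv f x D -> sderiv g x E ->
  sderiv (fun z => f z * g z) x (D * g x + f x * E).
Proof.
move=> Hf Hg e e0.
have K0 : 0 <= cmod (g x) + cmod (f x) + 2 + cmod D + cmod E.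
  have := (cmod_ge0 (g x), cmod_ge0 (f x), cmod_ge0 D, cmod_ge0 E).
  by case=> [] [] [] ? ? ? ?; lra.
have [a [a0 a1 aK]] := small_factor K0 e0.
have [d1 d10 H1] := Hf _ a0; have [d2 d20 H2] := Hg _ a0.
have [d3 d30 H3] := sderiv_cont Hf a0.
have [d4 d40 H4] := sderiv_cont Hg a0.
have [b [b0 bd1 bd2]] := min2_gt0 d10 d20.
have [c [c0 cd3 cd4]] := min2_gt0 d30 d40.
have [d [d0 db dc]] := min2_gt0 b0 c0.
exists d => // u v ud vd.
have h1 := H1 u v (lt_le_trans ud (le_trans db bd1)) (lt_le_trans vd (le_trans db bd1)).
have h2 := H2 u v (lt_le_trans ud (le_trans db bd2)) (lt_le_trans vd (le_trans db bd2)).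
have h3 := H3 v (lt_le_trans vd (le_trans dc cd3)).
have h4 := H4 u (lt_le_trans ud (le_trans dc cd4)).
have -> : f u * g u - f v * g v - (D * g x + f x * E) * (u - v) =
  (f u - f v - D * (u - v)) * g u + f v * (g u - g v - E * (u - v))
   + (u - v) * (D * (g u - g x) + E * (f v - f x)) by ring.
have gu : cmod (g u) <= cmod (g x) + 1.
  by have := cmodB_ge (g u) (g x); lra.
have fv : cmod (f v) <= cmod (f x) + 1.
  by have := cmodB_ge (f v) (f x); lra.
have uv := cmod_ge0 (u - v).
apply: (@le_trans _ _ (a * cmod (u - v) * (cmod (g x) + 1)
   + (cmod (f x) + 1) * (a * cmod (u - v)) + cmod (u - v) * (cmod D * a + cmod E * a))).
  apply: le_trans (cmodD _ _) _; apply: lerD.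
    apply: le_trans (cmodD _ _) _; rewrite !cmodM.
    by apply: lerD; apply: ler_pM; rewrite ?cmod_ge0.
  rewrite cmodM ler_wpM2l //; apply: le_trans (cmodD _ _) _; rewrite !cmodM.
  by apply: lerD; apply: ler_wpM2l; rewrite ?cmod_ge0 ?ltW.
have := ler_wpM2r uv aK; lra.
Qed.

Lemma sderiv_comp f g x D E : sderiv f x D -> sderiv g (f x) E ->
  sderiv (g \o f) x (E * D).
Proof.
move=> Hf Hg e e0.
have K0 : 0 <= cmod D + 1 + cmod E.
  by have := cmod_ge0 D; have := cmod_ge0 E; lra.
have [a [a0 a1 aK]] := small_factor K0 e0.
have [d1 d10 H1] := Hf _ a0; have [d2 d20 H2] := Hg _ a0.
have [d3 d30 H3] := sderiv_cont Hf d20.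
have [d4 d40 H4] := sderiv_lip Hf.
have [b [b0 bd1 bd2]] := min2_gt0 d10 d30.
have [d [d0 db dd4]] := min2_gt0 b0 d40.
exists d => // u v ud vd /=.
have h1 := H1 u v (lt_le_trans ud (le_trans db bd1)) (lt_le_trans vd (le_trans db bd1)).
have h2 := H2 _ _ (H3 u (lt_le_trans ud (le_trans db bd2)))
                  (H3 v (lt_le_trans vd (le_trans db bd2))).
have h4 := H4 u v (lt_le_trans ud dd4) (lt_le_trans vd dd4).
have -> : g (f u) - g (f v) - E * D * (u - v) =
  (g (f u) - g (f v) - E * (f u - f v)) + E * (f u - f v - D * (u - v)) by ring.
apply: le_trans (cmodD _ _) _; rewrite cmodM.
have i1 := ler_wpM2l (ltW a0) h4.
have i2 := ler_wpM2l (cmod_ge0 E) h1.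
have := ler_wpM2r (cmod_ge0 (u - v)) aK; lra.
Qed.

Lemma sderiv_inv x : x != 0 -> sderiv (fun z => z^-1) x (- x ^- 2).
Proof.
move=> x0 e e0; have cx : 0 < cmod x by rewrite cmod_gt0.
have c2 : 0 < cmod x / 2 by lra.
(* Near [x] both [u] and [v] have modulus at least [|x| / 2], so [|x^-2 u^-1 v^-1| <= 4 / |x|^4];
   the factor [2 (|x| + 1)] comes from [v (u - x) + x (v - x)] in the identity below. *)
pose K := 4 / cmod x ^+ 4 * (2 * (cmod x + 1)).
have K0 : 0 <= K by rewrite /K !mulr_ge0 ?invr_ge0 ?exprn_ge0 ?ltW //; lra.
have [a [a0 a1 aK]] := small_factor K0 e0.
have [d [d0 dc da]] := min2_gt0 c2 a0.
exists d => // u v ud vd.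
have cu : cmod x / 2 <= cmod u.
  by have := cmodB_ge x u; rewrite cmodC; lra.
have cv : cmod x / 2 <= cmod v.
  by have := cmodB_ge x v; rewrite cmodC; lra.
have u0 : u != 0 by rewrite -cmod_gt0; lra.
have v0 : v != 0 by rewrite -cmod_gt0; lra.
have -> : u^-1 - v^-1 - - x ^- 2 * (u - v) =
   (u - v) * ((v * (u - x) + x * (v - x)) * ((x ^- 2 * (u^-1 * v^-1)))).
  by field; rewrite x0 u0 v0.
rewrite mulrC !cmodM ler_wpM2r ?cmod_ge0 //.
have cvu : cmod v <= cmod x + 1.
  by have := cmodB_ge v x; lra.
apply: le_trans aK.
have -> : a * K = (2 * (cmod x + 1) * a) * (4 / cmod x ^+ 4) by rewrite /K; ring.
apply: ler_pM; rewrite ?mulr_ge0 ?cmod_ge0 //; last first.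
  have -> : 4 / cmod x ^+ 4 = (cmod x ^+ 2)^-1 * ((cmod x / 2)^-1 * (cmod x / 2)^-1).
    by field; rewrite gt_eqF.
  rewrite !cmodV cmodX ler_wpM2l ?invr_ge0 ?exprn_ge0 ?cmod_ge0 //.
  by apply: ler_pM; rewrite ?invr_ge0 ?cmod_ge0 // lef_pV2 ?posrE //; lra.
apply: le_trans (cmodD _ _) _; rewrite !cmodM.
have i1 : cmod v * cmod (u - x) <= (cmod x + 1) * a.
  by apply: ler_pM; rewrite ?cmod_ge0 // ltW // (lt_le_trans ud).
have i2 : cmod x * cmod (v - x) <= (cmod x + 1) * a.
  by apply: ler_pM; rewrite ?cmod_ge0 ?lerDl // ltW // (lt_le_trans vd).
lra.
Qed.

Lemma sderiv_ext f g x D (d : R) : 0 < d ->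
  (forall u, cmod (u - x) < d -> f u = g u) -> sderiv f x D -> sderiv g x D.
Proof.
move=> d0 fg Hf e e0; have [d1 d10 H1] := Hf _ e0.
have [d2 [d20 h1 h2]] := min2_gt0 d0 d10.
exists d2 => // u v ud vd.
rewrite -fg ?(lt_le_trans ud) // -fg ?(lt_le_trans vd) //.
by apply: H1; [exact: lt_le_trans h2|exact: lt_le_trans h2].
Qed.

Lemma sderiv_unique f x D E : sderiv f x D -> sderiv f x E -> D = E.
Proof.
move=> HD HE; apply/eqP; rewrite -subr_eq0 -cmod_eq0; apply: contraT => ne0.
have DE0 : 0 < cmod (D - E) by rewrite lt0r ne0 cmod_ge0.
have e0 : 0 < cmod (D - E) / 4 by lra.
have [d1 d10 H1] := HD _ e0; have [d2 d20 H2] := HE _ e0.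
have [d [d0 h1 h2]] := min2_gt0 d10 d20.
have d2' : 0 < d / 2 by lra.
pose u := x + (d / 2)%:C%C.
have ux : cmod (u - x) = d / 2.
  by rewrite /u addrC addKr cmod_real ger0_norm // ltW.
have ud : cmod (u - x) < d by rewrite ux; lra.
have xd : cmod (x - x) < d by rewrite subrr cmod0.
have i1 := H1 u x (lt_le_trans ud h1) (lt_le_trans xd h1).
have i2 := H2 u x (lt_le_trans ud h2) (lt_le_trans xd h2).
have : cmod ((D - E) * (u - x)) <= cmod (D - E) / 2 * cmod (u - x).
  have -> : (D - E) * (u - x) = (f u - f x - E * (u - x)) - (f u - f x - D * (u - x)) by ring.
  apply: le_trans (cmodD _ _) _; rewrite cmodN; lra.
rewrite cmodM ler_pM2r ?ux //; lra.
Qed.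

Lemma sderiv_inj f x D : D != 0 -> sderiv f x D -> exists2 d : R, 0 < d &
  forall u v, cmod (u - x) < d -> cmod (v - x) < d -> f u = f v -> u = v.
Proof.
move=> D0 H; have cD : 0 < cmod D by rewrite cmod_gt0.
have e0 : 0 < cmod D / 2 by lra.
have [d d0 {}H] := H _ e0; exists d => // u v ud vd fuv.
have := H u v ud vd; rewrite fuv subrr sub0r cmodN cmodM.
have := cmod_ge0 (u - v) => c0 h.
apply/eqP; rewrite -subr_eq0 -cmod_eq0; apply/eqP/le_anti; rewrite c0 andbT.
have h' : (cmod D / 2) * cmod (u - v) <= 0 by lra.
by rewrite -(pmulr_rle0 _ e0).
Qed.

Lemma sderiv_poly (p : {poly C}) x : sderiv (horner p) x p^`().[x].
Proof.
elim/poly_ind: p => [|p c IH].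
  rewrite deriv0 horner0; apply: (@sderiv_ext (fun=> 0) _ _ _ 1) => //.
    by move=> u _; rewrite horner0.
  exact: sderiv_const.
rewrite derivMXaddC !hornerE.
apply: (@sderiv_ext (fun z => p.[z] * z + c) _ _ _ 1) => //.
  by move=> u _; rewrite !hornerE.
have -> : p.[x] + p^`().[x] * x = (p^`().[x] * x + p.[x] * 1) + 0 by ring.
exact: sderivD (sderivM IH (sderiv_id x)) (sderiv_const c x).
Qed.

Lemma poly_cont (p : {poly C}) x : ccont (horner p) x.
Proof. exact: sderiv_cont (sderiv_poly p x). Qed.

(** The numerator of the derivative of [P / Q]; away from the zeros of [Q], its roots are the
    critical points. *)
Definition wronsk (P Q : {poly C}) := P^`() * Q - P * Q^`().

Lemma sderiv_quotient (P Q : {poly C}) x : Q.[x] != 0 ->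
  sderiv (fun z => P.[z] / Q.[z]) x ((wronsk P Q).[x] / Q.[x] ^+ 2).
Proof.
move=> Q0.
have -> : (wronsk P Q).[x] / Q.[x] ^+ 2 =
   P^`().[x] * Q.[x]^-1 + P.[x] * ((- Q.[x] ^- 2) * Q^`().[x]).
  by rewrite /wronsk hornerD hornerN !hornerM; field.
apply: sderivM; first exact: sderiv_poly.
exact: (sderiv_comp (sderiv_poly Q x) (sderiv_inv Q0)).
Qed.

Lemma poly_neq0_near (Q : {poly C}) x : Q.[x] != 0 ->
  exists2 d : R, 0 < d & forall u, cmod (u - x) < d -> Q.[u] != 0.
Proof.
move=> Q0; have cQ : 0 < cmod Q.[x] by rewrite cmod_gt0.
have [d d0 H] := @poly_cont Q x _ cQ; exists d => // u /H.
apply: contraTneq => ->; rewrite sub0r cmodN; lra.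
Qed.

End StrictDerivative.

(** * Rational maps fixing infinity *)

Section ProperRational.
Variable R : realType.
Local Notation C := R[i].
Implicit Types (x y z u v t : C) (P Q G A B : {poly C}).

(* The quotients [P / Q] fixing infinity: proper maps from the complement of
   the poles onto the plane. *)
Definition proper_pair P Q :=
  [/\ (size Q < size P)%N, Q != 0 & forall x, Q.[x] = 0 -> P.[x] != 0].

Lemma poly_bounded (P : {poly C}) (M : R) :
  exists2 K : R, 0 <= K & forall x, cmod x <= M -> cmod P.[x] <= K.
Proof.
elim/poly_ind: P => [|P c [K K0 IH]].
  by exists 0 => // x _; rewrite horner0 cmod0.
exists (K * `|M| + cmod c); first by rewrite addr_ge0 ?mulr_ge0 ?cmod_ge0.
move=> x xM; rewrite !hornerE; apply: le_trans (cmodD _ _) _.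
rewrite lerD2r cmodM; apply: ler_pM; rewrite ?cmod_ge0 ?IH //.
by apply: le_trans xM _; exact: ler_norm.
Qed.

(** Since [Q] has smaller degree, the leading term of [P - y Q] does not depend on [y]. For
    [|x| >= 1] the other terms are at most [S |x|^(n-1)], so a root cannot be large. *)
Lemma preimage_bounded P Q (Y : R) : (size Q < size P)%N -> (1 < size P)%N ->
  exists M : R, forall x y, cmod y <= Y -> P.[x] = y * Q.[x] -> cmod x <= M.
Proof.
move=> sQP sP1; set n := (size P).-1.
have n0 : (0 < n)%N by rewrite /n -subn1 subn_gt0.
have sP : size P = n.+1 by rewrite /n prednK // (leq_ltn_trans _ sQP).
have lP : P`_n != 0 by rewrite -[n]/(size P).-1 -lead_coefE lead_coef_eq0 -size_poly_eq0 sP.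
have cl : 0 < cmod P`_n by rewrite cmod_gt0.
pose S := \sum_(i < n) (cmod P`_i + `|Y| * cmod Q`_i).
have S0 : 0 <= S by apply: sumr_ge0 => i _; rewrite addr_ge0 ?mulr_ge0 ?cmod_ge0.
exists (1 + S / cmod P`_n) => x y yY PyQ.
rewrite leNgt; apply/negP => Mx.
have SP0 : 0 <= S / cmod P`_n by rewrite divr_ge0 // ltW.
have x1 : 1 <= cmod x by lra.
have : P`_n * x ^+ n = - \sum_(i < n) (P`_i - y * Q`_i) * x ^+ i.
  have : (P - y *: Q).[x] = 0 by rewrite !hornerE PyQ subrr.
  rewrite (@horner_coef_wide _ n.+1); last first.
    rewrite -sP; apply: leq_trans (size_polyD _ _) _; rewrite geq_max leqnn size_polyN.
    by apply: leq_trans (size_scale_leq _ _) _; rewrite ltnW.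
  rewrite big_ord_recr /= !coefE (@nth_default _ 0 Q) ?mulr0 ?subr0; last first.
    by rewrite -ltnS -sP.
  move/eqP; rewrite addrC addr_eq0 => /eqP ->; congr (- _).
  by apply: eq_bigr => i _; rewrite !coefE.
move/(congr1 (@cmod R)); rewrite cmodN cmodM cmodX => E.
have : cmod P`_n * cmod x ^+ n <= S * cmod x ^+ n.-1.
  rewrite E; apply: le_trans (cmod_sum _ _) _.
  rewrite /S mulr_suml; apply: ler_sum => i _.
  rewrite cmodM cmodX; apply: ler_pM; rewrite ?cmod_ge0 ?exprn_ge0 ?cmod_ge0 //.
    apply: le_trans (cmodD _ _) _; rewrite cmodN cmodM lerD2l ler_wpM2r ?cmod_ge0 //.
    by apply: le_trans yY _; exact: ler_norm.
  by apply: ler_weXn2l => //; rewrite -ltnS prednK.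
have -> : cmod x ^+ n = cmod x * cmod x ^+ n.-1 by rewrite -exprS prednK.
rewrite mulrA ler_pM2r ?exprn_gt0 //; last by lra.
rewrite mulrC -ler_pdivlMr //; lra.
Qed.

Lemma deriv_neq0 P : (1 < size P)%N -> P^`() != 0.
Proof.
case E: (size P) => [|[|n]] // _; apply/eqP => /(congr1 (fun p : {poly C} => p`_n)).
rewrite /= coef_deriv coef0 => /eqP; rewrite mulrn_eq0 /=.
have -> : P`_n.+1 = lead_coef P by rewrite lead_coefE E.
by rewrite lead_coef_eq0 -size_poly_eq0 E.
Qed.

Lemma min_expr_le_prod (T : eqType) (b : T -> R) (rs : seq T) :
  (forall z : T, 0 <= b z) -> rs != [::] ->
  exists2 z : T, z \in rs & b z ^+ size rs <= \prod_(w <- rs) b w.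
Proof.
move=> b0; elim: rs => // w rs IH _.
have [->|/IH[z zrs Hz]] := eqVneq rs [::].
  by exists w; rewrite ?inE // big_seq1 expr1.
rewrite big_cons /=.
have [le|/ltW le] := leP (b w) (b z).
  exists w; rewrite ?inE ?eqxx // exprS ler_wpM2l //.
  by apply: le_trans Hz; apply: lerXn2r; rewrite ?nnegrE.
exists z; first by rewrite inE zrs orbT.
by rewrite exprS; apply: ler_pM => //; rewrite exprn_ge0.
Qed.

(** Quantitative openness: the value of [P - y Q] at [x] is the leading coefficient of [P] times the
    product of the differences between [x] and its roots, so the nearest root [x'] obeys the bound.
    It is no pole, because [P] and [Q] have no common zero. *)
Lemma proper_near_root P Q x y : proper_pair P Q ->
  exists x', [/\ Q.[x'] != 0, P.[x'] / Q.[x'] = y &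
    cmod (x - x') ^+ (size P).-1 <= cmod (P.[x] - y * Q.[x]) / cmod (lead_coef P)].
Proof.
case=> sQP Q0 nz; pose G := P - y *: Q.
have sQ : (0 < size Q)%N by rewrite lt0n size_poly_eq0.
have syQ : (size (- (y *: Q)) < size P)%N.
  by rewrite size_polyN; apply: leq_ltn_trans sQP; exact: size_scale_leq.
have sG : size G = size P by rewrite /G size_polyDl.
have lG : lead_coef G = lead_coef P by rewrite /G lead_coefDl.
have P0 : P != 0 by rewrite -size_poly_gt0 (leq_ltn_trans _ sQP).
have l0 : lead_coef P != 0 by rewrite lead_coef_eq0.
have [rs Grs] := closed_field_poly_normal G.
have srs : size rs = (size P).-1.
  by rewrite -sG Grs lG size_scale // size_prod_XsubC.
have rs0 : rs != [::].
  by rewrite -size_eq0 srs -lt0n -subn1 subn_gt0 (leq_ltn_trans sQ).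
have [x' x'rs Hx'] := @min_expr_le_prod _ (fun z => cmod (x - z)) _ (fun=> cmod_ge0 _) rs0.
have Gx' : G.[x'] = 0.
  apply/rootP; rewrite Grs rootZ ?lG // root_prod_XsubC //.
have Qx' : Q.[x'] != 0.
  apply/eqP => Qx'; have := nz _ Qx'; apply/negP; rewrite negbK.
  by move: Gx'; rewrite /G !hornerE Qx' mulr0 subr0 => ->.
exists x'; split => //.
  by move/eqP: Gx'; rewrite /G !hornerE subr_eq0 => /eqP ->; rewrite mulfK.
rewrite -srs; apply: le_trans Hx' _.
have -> : P.[x] - y * Q.[x] = G.[x] by rewrite /G !hornerE.
rewrite Grs hornerZ cmodM lG mulrC mulKf; last by rewrite cmod_eq0.
rewrite horner_prod le_eqVlt; apply/orP; left; apply/eqP.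
elim: rs {Grs srs rs0 x'rs} => [|w rs IH]; first by rewrite !big_nil cmod1.
by rewrite !big_cons cmodM IH !hornerE.
Qed.

(* A nonconstant [A / B] is locally [c + a (u - x) ^+ k + ...] with [a != 0], so
   some direction increases its modulus. *)
Lemma local_max_quotient A B x (d : R) : 0 < d -> B.[x] != 0 ->
  (forall u, cmod (u - x) < d -> cmod (A.[u] * B.[x]) <= cmod (A.[x] * B.[u])) ->
  B.[x] *: A = A.[x] *: B.
Proof.
move=> d0 Bx0 H; apply/eqP; rewrite -subr_eq0; apply: contraT => E0.
set E := _ - _ in E0.
have Ex : E.[x] = 0 by rewrite /E !hornerE mulrC subrr.
have [k [E1]] := multiplicity_XsubC E x; rewrite E0 /= => E1x EE.
have E1x0 : E1.[x] != 0 by [].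
have k0 : (0 < k)%N.
  by case: k EE => // EE; move: Ex; rewrite EE expr0 mulr1 => /eqP; rewrite (negPf E1x0).
have Eu u : E.[u] = A.[u] * B.[x] - A.[x] * B.[u].
  by rewrite /E !hornerE; ring.
have EuF u : E.[u] = E1.[u] * (u - x) ^+ k by rewrite EE !hornerE.
have [Ax0|Ax0] := eqVneq A.[x] 0.
  have [d1 d10 H1] := poly_neq0_near E1x0.
  have [d2 [d20 d2d d2d1]] := min2_gt0 d0 d10.
  pose u := x + (d2 / 2)%:C%C.
  have ux : u - x = (d2 / 2)%:C%C by rewrite /u addrC addKr.
  have cux : cmod (u - x) = d2 / 2 by rewrite ux cmod_real ger0_norm //; lra.
  have ux0 : u - x != 0 by rewrite -cmod_gt0 cux; lra.
  have : cmod E.[u] <= 0.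
    rewrite Eu Ax0 mul0r subr0; have := H u; rewrite Ax0 mul0r cmod0; apply.
    by rewrite cux; lra.
  rewrite leNgt cmod_gt0 EuF mulf_neq0 //; first by apply: H1; rewrite cux; lra.
  by rewrite expf_neq0.
(* In the direction [w] the difference [E.[u]] equals [s ^+ k * rho] times [A.[x] * B.[u]] with
   [rho] close to 1, so the ratio of the two compared products is [1 + s ^+ k * rho], of real part
   above 1. *)
pose w := k.-root (E1.[x] / (A.[x] * B.[x]))^-1.
have wk : w ^+ k = (E1.[x] / (A.[x] * B.[x]))^-1 by rewrite /w rootCK.
have w0 : w != 0.
  apply/eqP => w0; move: wk; rewrite w0 expr0n gtn_eqF // => /esym/eqP.
  by rewrite invr_eq0 !mulf_eq0 invr_eq0 mulf_eq0 (negPf E1x0) (negPf Ax0) (negPf Bx0).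
have cw : 0 < cmod w by rewrite cmod_gt0.
have AB0 : (A.[x] *: B).[x] != 0 by rewrite hornerZ mulf_neq0.
have half : 0 < 2^-1 :> R by lra.
have [d1 d10 H1] := sderiv_cont (@sderiv_quotient _ (w ^+ k *: E1) _ x AB0) half.
have [d2 d20 H2] := poly_neq0_near Bx0.
have [a [a0 ad ad1]] := min2_gt0 d0 d10.
have [b [b0 ba bd2]] := min2_gt0 a0 d20.
pose s := b / 2 / cmod w.
have s0 : 0 < s by rewrite !divr_gt0.
pose u := x + s%:C%C * w.
have ux : u - x = s%:C%C * w by rewrite /u addrC addKr.
have cux : cmod (u - x) = b / 2.
  by rewrite ux cmodM cmod_real ger0_norm ?(ltW s0) // /s divfK // gt_eqF.
have Bu0 : B.[u] != 0 by apply: H2; rewrite cux; lra.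
have := H1 u; rewrite cux => /(_ ltac:(lra)).
have -> : (w ^+ k *: E1).[x] / (A.[x] *: B).[x] = 1.
  by rewrite !hornerZ wk; field; rewrite E1x0 Bx0 Ax0.
set rho := _ / _ => rho1.
have Erho : E.[u] = (s ^+ k)%:C%C * rho * (A.[x] * B.[u]).
  rewrite EuF ux exprMn rmorphXn /= /rho !hornerZ; field.
  by rewrite Ax0 Bu0.
have := H u; rewrite cux => /(_ ltac:(lra)).
have -> : A.[u] * B.[x] = (1 + (s ^+ k)%:C%C * rho) * (A.[x] * B.[u]).
  by rewrite mulrDl mul1r -Erho Eu; ring.
rewrite cmodM ger_pMl; last by rewrite cmod_gt0 mulf_neq0.
move=> le1; have := norm_re_le (rho - 1); have := norm_re_le (1 + (s ^+ k)%:C%C * rho).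
have sk0 : 0 < s ^+ k by rewrite exprn_gt0.
case: rho {Erho} rho1 le1 => a1 b1 h1 h2 /= h3 h4.
have : -a1 + 1 < 2^-1.
  apply: le_lt_trans h1; apply: le_trans h4.
  by rewrite -normrN opprB addrC; apply: ler_norm.
have : 1 + (s ^+ k * a1 - 0 * b1) <= 1.
  by apply: le_trans h2; apply: le_trans h3; apply: ler_norm.
rewrite mul0r subr0 gerDl pmulr_rle0 //; lra.
Qed.

End ProperRational.

(** * Inverse branches *)


Section InverseBranch.
Variable R : realType.
Local Notation C := R[i].
Implicit Types (x y z u v t : C) (P Q G A B : {poly C}).

(** Sequential compactness is used twice: on a sequence along which [phi] would be unbounded, then
    on a maximizing sequence. Continuity is relative to the disc because branches are controlled
    only there. *)
Lemma closed_disc_max (phi : C -> R) y0 (r : R) : 0 <= r ->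
  (forall t, cmod (t - y0) <= r -> forall e : R, 0 < e -> exists2 d : R, 0 < d &
     forall t', cmod (t' - y0) <= r -> cmod (t' - t) < d -> `|phi t' - phi t| < e) ->
  exists2 t, cmod (t - y0) <= r & forall t', cmod (t' - y0) <= r -> phi t' <= phi t.
Proof.
move=> r0 cphi; pose D := [set t | cmod (t - y0) <= r]%classic.
have Dy : D y0 by rewrite /D /= subrr cmod0.
have bnd (u : nat -> C) : (forall n, D (u n)) -> exists2 l, D l &
    forall (e : R) (N : nat), 0 < e -> exists2 n, (N <= n)%N & cmod (u n - l) < e.
  move=> Du; have [|l Hl] := @bounded_cluster_point R u (cmod y0 + r).
    by move=> n; have := cmodB_ge (u n) y0; have := Du n; rewrite /D /=; lra.
  exists l => //; rewrite /D /=; apply/ler_addgt0Pr => e e0.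
  have [n _ Hn] := Hl e 0%N e0.
  by have := cmod_tri (u n) l y0; have := Du n; rewrite /D /= (cmodC l (u n)); lra.
have ub : has_ubound (phi @` D)%classic.
  apply: contrapT => nub.
  have big n : exists t, D t /\ n%:R < phi t.
    apply: contrapT => nex; apply: nub; exists n%:R => _ [t Dt <-].
    by rewrite leNgt; apply/negP => lt; apply: nex; exists t.
  have [u Hu] := choice big.
  have [l Dl Hl] := bnd u (fun n => (Hu n).1).
  have [d d0 Hd] := cphi _ Dl _ ltr01.
  pose m := Num.bound `|phi l + 1|.
  have [n mn hn] := Hl d m d0.
  have := Hd _ (Hu n).1 hn; have := (Hu n).2.
  have : `|phi l + 1| < n%:R.
    by apply: lt_le_trans (archi_boundP (normr_ge0 _)) _; rewrite ler_nat.
  have := ler_norm (phi l + 1); have := ler_norm (phi (u n) - phi l); lra.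
have sup := conj (ex_intro (phi @` D)%classic (phi y0) (ex_intro2 _ _ y0 Dy erefl)) ub.
set s := reals.sup (phi @` D)%classic.
have near n : exists t, D t /\ s - n.+1%:R^-1 < phi t.
  have [|_ [t Dt <-] lt] := @sup_adherent R (phi @` D)%classic n.+1%:R^-1 _ sup.
    by rewrite invr_gt0.
  by exists t.
have [u Hu] := choice near.
have [l Dl Hl] := bnd u (fun n => (Hu n).1).
exists l => // t Dt.
have ts : phi t <= s by apply: ub_le_sup => //; exists t.
apply: le_trans ts _; apply/ler_addgt0Pr => e e0.
have e2 : 0 < e / 2 by lra.
have [d d0 Hd] := cphi _ Dl _ e2.
pose m := Num.bound (e / 2)^-1.
have [n mn hn] := Hl d m d0.
have := Hd _ (Hu n).1 hn; have := (Hu n).2.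
have : n.+1%:R^-1 < e / 2 :> R.
  rewrite -[ltRHS]invrK ltf_pV2 ?posrE ?invr_gt0 //.
  apply: lt_le_trans (archi_boundP _) _; first by rewrite invr_ge0 ltW.
  by rewrite ler_nat; apply: leqW.
move: (n.+1%:R^-1) (ler_norm (phi (u n) - phi l)) => q; lra.
Qed.

(** At an interior maximum [t], the openness of [g] turns the maximum along [g] into a local maximum
    of [|A / B|] in the plane at [g t]. Then [A / B] is constant, and any boundary point serves. *)
Lemma quotient_max_principle (g : C -> C) A B y0 (r : R) : 0 < r ->
  (forall t, cmod (t - y0) <= r -> forall e : R, 0 < e -> exists2 d : R, 0 < d &
     forall t', cmod (t' - y0) <= r -> cmod (t' - t) < d -> cmod (g t' - g t) < e) ->
  (forall t, cmod (t - y0) < r -> exists2 d : R, 0 < d &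
     forall x, cmod (x - g t) < d -> exists2 t', cmod (t' - y0) <= r & g t' = x) ->
  (forall t, cmod (t - y0) <= r -> B.[g t] != 0) ->
  exists2 t, cmod (t - y0) = r &
    cmod (A.[g y0] / B.[g y0]) <= cmod (A.[g t] / B.[g t]).
Proof.
move=> r0 gc go B0; pose phi t := cmod (A.[g t] / B.[g t]).
have yy : cmod (y0 - y0) <= r by rewrite subrr cmod0 ltW.
have [|t Dt tmax] := @closed_disc_max phi y0 r (ltW r0).
  move=> t Dt e e0.
  have [d1 d10 H1] := sderiv_cont (@sderiv_quotient _ A B _ (B0 _ Dt)) e0.
  have [d d0 H] := gc _ Dt _ d10; exists d => // t' Dt' /(H _ Dt') /H1.
  rewrite /phi; set a := _ / _; set b := _ / _ => ab.
  by rewrite ltr_norml; have := cmodB_ge a b; have := cmodB_ge b a; rewrite (cmodC b); lra.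
have [tr|tr] := eqVneq (cmod (t - y0)) r.
  by exists t => //; exact: tmax.
have lt : cmod (t - y0) < r by rewrite lt_neqAle tr.
have [d d0 H] := go _ lt.
have E : B.[g t] *: A = A.[g t] *: B.
  apply: (@local_max_quotient _ _ _ _ d) => //; first exact: B0.
  move=> u /H[t' Dt' <-]; have := tmax _ Dt'.
  rewrite /phi !cmodM !cmodV ler_pdivrMr ?cmod_gt0 ?B0 //.
  by rewrite mulrAC ler_pdivlMr ?cmod_gt0 ?B0.
have cst t' : cmod (t' - y0) <= r -> A.[g t'] / B.[g t'] = A.[g t] / B.[g t].
  move=> Dt'; have /(congr1 (fun p : {poly C} => p.[g t'])) := E.
  rewrite !hornerZ => e; apply/eqP; rewrite eqr_div ?B0 //; apply/eqP.
  by rewrite mulrC e.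
have Dr : cmod (y0 + r%:C%C - y0) = r by rewrite addrC addKr cmod_real gtr0_norm.
by exists (y0 + r%:C%C) => //; rewrite !cst // Dr.
Qed.

(** * Lifting a closed disc through a rational map without critical points over it *)

Section Branch.
Variables (P Q : {poly C}) (y0 : C) (r : R).
Hypothesis PQ : proper_pair P Q.
Let F x := P.[x] / Q.[x].
Let E x := Q.[x] != 0 /\ cmod (F x - y0) <= r.
Hypothesis noncrit : forall x, E x -> (wronsk P Q).[x] != 0.

Let Ebounded : exists M : R, forall x, E x -> cmod x <= M.
Proof.
have [sQP Q0 _] := PQ; have sQ : (0 < size Q)%N by rewrite size_poly_gt0.
have [M HM] := preimage_bounded (cmod y0 + r) sQP (leq_ltn_trans sQ sQP).
exists M => x [Qx Fx]; apply: (HM x (F x)); last by rewrite /F divfK.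
by have := cmodB_ge (F x) y0; lra.
Qed.

(** A limit of points of [E] is not a pole: there [P = Q * F] with [F] bounded on [E] would tend to
    0, whereas [P] does not vanish at a zero of [Q]. *)
Let Eclosed l : (forall e : R, 0 < e -> exists2 x, E x & cmod (x - l) < e) -> E l.
Proof.
move=> Hl; have Ql : Q.[l] != 0.
  apply/eqP => Ql; have [_ _ /(_ _ Ql) Pl] := PQ.
  have cP : 0 < cmod P.[l] / 2 by rewrite divr_gt0 // cmod_gt0.
  have [d1 d10 H1] := @poly_cont R P l _ cP.
  have K0 : 0 <= cmod y0 + `|r| by rewrite addr_ge0 ?cmod_ge0.
  have [a [a0 _ aK]] := small_factor K0 cP.
  have [d2 d20 H2] := @poly_cont R Q l _ a0.
  have [d [d0 dd1 dd2]] := min2_gt0 d10 d20.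
  have [x [Qx Fx] xl] := Hl _ d0.
  have h1 := H1 _ (lt_le_trans xl dd1); have h2 := H2 _ (lt_le_trans xl dd2).
  rewrite Ql subr0 in h2.
  have : cmod P.[x] <= a * (cmod y0 + `|r|).
    have -> : P.[x] = Q.[x] * F x by rewrite /F mulrC divfK.
    rewrite cmodM; apply: ler_pM; rewrite ?cmod_ge0 ?(ltW h2) //.
    by have := cmodB_ge (F x) y0; have := ler_norm r; lra.
  by have := cmodB_ge P.[l] P.[x]; rewrite (cmodC P.[l] P.[x]); lra.
split=> //; apply/ler_addgt0Pr => e e0.
have [d d0 H] := sderiv_cont (@sderiv_quotient _ P Q _ Ql) e0.
have [x [Qx Fx] xl] := Hl _ d0.
by have := H _ xl; have := cmod_tri (F x) (F l) y0; rewrite (cmodC (F l) (F x)) -/(F x) -/(F l); lra.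
Qed.

(** By compactness: pairs in a common fibre at distances tending to 0 would accumulate at a point of
    [E], where [F] is locally injective because it is noncritical. *)
Let separated : exists2 eta : R, 0 < eta & forall x x', E x -> E x' ->
  F x = F x' -> cmod (x - x') < eta -> x = x'.
Proof.
apply: contrapT => nsep.
have bad n : exists xx : C * C, [/\ E xx.1, E xx.2, F xx.1 = F xx.2,
     cmod (xx.1 - xx.2) < n.+1%:R^-1 & xx.1 <> xx.2].
  apply: contrapT => nex; apply: nsep; exists n.+1%:R^-1; first by rewrite invr_gt0.
  move=> x x' Ex Ex' FF lt; apply: contrapT => ne; apply: nex.
  by exists (x, x').
have [u Hu] := choice bad.
have [M HM] := Ebounded.
have [|l Hl] := @bounded_cluster_point R (fun n => (u n).1) M.
  by move=> n; have [? _ _ _ _] := Hu n; exact: HM.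
have El : E l.
  apply: Eclosed => e e0; have [n _ Hn] := Hl e 0%N e0.
  by exists (u n).1 => //; have [] := Hu n.
have D0 : (wronsk P Q).[l] / Q.[l] ^+ 2 != 0.
  by rewrite mulf_neq0 ?invr_eq0 ?expf_neq0 ?noncrit //; case: El.
have [d d0 Hd] := sderiv_inj D0 (sderiv_quotient P El.1).
have d2 : 0 < d / 2 by lra.
pose m := Num.bound (d / 2)^-1.
have [n mn hn] := Hl _ m d2.
have [_ _ FF lt ne] := Hu n; apply: ne; apply: Hd => //; first by lra.
have : n.+1%:R^-1 < d / 2 :> R.
  rewrite -[ltRHS]invrK ltf_pV2 ?posrE ?invr_gt0 //.
  apply: lt_le_trans (archi_boundP _) _; first by rewrite invr_ge0 ltW.
  by rewrite ler_nat; apply: leqW.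
move: (n.+1%:R^-1) lt (cmod_tri (u n).1 (u n).2 l) => q.
by rewrite (cmodC (u n).2 (u n).1); lra.
Qed.

(** The choice of [d] is uniform because [|Q|] is bounded on the bounded set [E], so that [P.[x] - y
    * Q.[x] = (F x - y) * Q.[x]] is small and [proper_near_root] applies. *)
Let near_lift (e : R) : 0 < e -> exists2 d : R, 0 < d & forall x y, E x ->
  cmod (y - y0) <= r -> cmod (F x - y) < d ->
  exists x', [/\ E x', F x' = y & cmod (x - x') < e].
Proof.
move=> e0; have [M HM] := Ebounded; have [K K0 HK] := poly_bounded Q M.
have [sQP Q0 nz] := PQ.
have P0 : P != 0 by rewrite -size_poly_gt0 (leq_ltn_trans _ sQP).
have l0 : 0 < cmod (lead_coef P) by rewrite cmod_gt0 lead_coef_eq0.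
have c0 : 0 < e ^+ (size P).-1 * cmod (lead_coef P) / 2 by rewrite divr_gt0 // mulr_gt0 // exprn_gt0.
have [d [d0 _ dK]] := small_factor K0 c0.
exists d => // x y Ex yr Fxy.
have [x' [Qx' Fx' le]] := proper_near_root x y PQ.
exists x'; split => //; first by split=> //; rewrite /F Fx'.
rewrite ltNge; apply/negP => ex.
have : e ^+ (size P).-1 <= cmod (x - x') ^+ (size P).-1.
  by apply: lerXn2r => //; rewrite nnegrE ?cmod_ge0 // ltW.
have : cmod (P.[x] - y * Q.[x]) <= d * K.
  have -> : P.[x] - y * Q.[x] = (F x - y) * Q.[x] by rewrite mulrBl /F divfK //; case: Ex.
  by rewrite cmodM; apply: ler_pM; rewrite ?cmod_ge0 ?(ltW Fxy) // HK // HM.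
move=> h1 h2; have := le_trans h2 le; rewrite ler_pdivlMr //.
have : 0 < e ^+ (size P).-1 * cmod (lead_coef P) by rewrite mulr_gt0 // exprn_gt0.
lra.
Qed.

(** All points of the disc are lifted simultaneously along radial segments cut into [N] short steps.
    Fibres being [eta]-separated, the lifts chosen at each step fit together. *)
Lemma inverse_branch x0 : 0 < r -> Q.[x0] != 0 -> F x0 = y0 ->
  exists g : C -> C, [/\ g y0 = x0,
   forall t, cmod (t - y0) <= r -> E (g t) /\ F (g t) = t,
   forall t, cmod (t - y0) <= r -> forall e : R, 0 < e -> exists2 d : R, 0 < d &
     forall t', cmod (t' - y0) <= r -> cmod (t' - t) < d -> cmod (g t' - g t) < e
   & forall t, cmod (t - y0) < r -> exists2 d : R, 0 < d &
     forall x, cmod (x - g t) < d -> exists2 t', cmod (t' - y0) <= r & g t' = x].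
Proof.
move=> r0 Qx0 Fx0; have [eta eta0 sep] := separated.
have Ex0 : E x0 by split=> //; rewrite Fx0 subrr cmod0 ltW.
(* A quarter, because the comparison of two lifts goes from [x'] through [h t], [g t] and [g t'] to
   [h t'], four jumps whose total must stay below [eta]. *)
have e0 : 0 < eta / 4 by lra.
have [d d0 Hd] := near_lift e0.
pose N := (Num.bound (r / d)).+1.
have N0 : 0 < N%:R :> R by rewrite ltr0n.
have rN : r / N%:R < d.
  rewrite ltr_pdivrMr // mulrC -ltr_pdivrMr //.
  apply: lt_le_trans (archi_boundP _) _; first by rewrite divr_ge0 // ltW.
  by rewrite ler_nat.
pose y k t := y0 + (k%:R / N%:R)%:C%C * (t - y0).
have yr k t : (k <= N)%N -> cmod (t - y0) <= r -> cmod (y k t - y0) <= r.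
  move=> kN tr; rewrite /y addrC addKr cmodM cmod_real ger0_norm ?divr_ge0 //.
  apply: le_trans tr; rewrite ler_piMl ?cmod_ge0 // ler_pdivrMr // mul1r.
  by rewrite ler_nat.
have ystep k t : cmod (t - y0) <= r -> cmod (y k t - y k.+1 t) < d.
  move=> tr; have -> : y k t - y k.+1 t = - ((N%:R^-1)%:C%C * (t - y0)).
    have -> : y k.+1 t = y k t + (N%:R^-1)%:C%C * (t - y0).
      by rewrite /y -natr1 mulrDl mul1r rmorphD /= mulrDl addrA.
    by rewrite opprD addrA subrr sub0r.
  rewrite cmodN cmodM cmod_real ger0_norm ?invr_ge0 ?ltW //.
  by apply: le_lt_trans rN; rewrite mulrC ler_pM2r // invr_gt0.
have yt k t t' : (k <= N)%N -> cmod (t' - t) < d -> cmod (y k t - y k t') < d.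
  move=> kN tt'; have -> : y k t - y k t' = (k%:R / N%:R)%:C%C * (t - t').
    by rewrite /y; ring.
  rewrite cmodM cmod_real ger0_norm ?divr_ge0 // (cmodC t); apply: le_lt_trans tt'.
  by rewrite ler_piMl ?cmod_ge0 // ler_pdivrMr // mul1r ler_nat.
have lift k : (k <= N)%N -> exists g : C -> C, [/\ g y0 = x0,
    forall t, cmod (t - y0) <= r -> E (g t) /\ F (g t) = y k t &
    forall t t', cmod (t - y0) <= r -> cmod (t' - y0) <= r -> cmod (t' - t) < d ->
      cmod (g t' - g t) < eta / 4].
  elim: k => [|k IH] kN.
    exists (fun=> x0); split=> //; last by move=> *; rewrite subrr cmod0.
    by move=> t _; rewrite /y mul0r rmorph0 mul0r addr0.
  have [g [g0 gF gc]] := IH (ltnW kN).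
  have ex t : exists x', cmod (t - y0) <= r ->
      [/\ E x', F x' = y k.+1 t & cmod (g t - x') < eta / 4].
    have [tr|] := boolP (cmod (t - y0) <= r); last by exists 0.
    have [Eg Fg] := gF t tr.
    have [|x' Hx'] := Hd _ _ Eg (yr _ _ kN tr); first by rewrite Fg ystep.
    by exists x'.
  have [h Hh] := choice ex; exists h; split.
  - have yy : cmod (y0 - y0) <= r by rewrite subrr cmod0 ltW.
    have [Eh Fh hc] := Hh _ yy; rewrite g0 in hc.
    apply: sep => //; last by rewrite cmodC; lra.
    by rewrite Fh Fx0 /y subrr mulr0 addr0.
  - by move=> t tr; have [] := Hh _ tr.
  - move=> t t' tr t'r tt'; have [Eh Fh hc] := Hh _ tr; have [Eh' Fh' hc'] := Hh _ t'r.
    have [|x' [Ex' Fx' hx']] := Hd _ _ Eh (yr _ _ kN t'r); first by rewrite Fh yt.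
    suff <- : x' = h t' by rewrite cmodC.
    apply: sep => //; first by rewrite Fx' Fh'.
    have := cmod_tri (h t) x' (h t'); have := cmod_tri (g t) (h t) (h t').
    have := cmod_tri (g t') (g t) (h t'); have := gc _ _ tr t'r tt'.
    rewrite (cmodC x' (h t)) (cmodC (h t) (g t)) (cmodC (g t) (g t')); lra.
have [g [g0 gF gc]] := lift N (leqnn _).
have yN t : y N t = t.
  by rewrite /y divff ?gt_eqF // rmorph1 mul1r addrC subrK.
have gF' t : cmod (t - y0) <= r -> E (g t) /\ F (g t) = t.
  by move=> /gF; rewrite yN.
have gcont t : cmod (t - y0) <= r -> forall e : R, 0 < e -> exists2 d : R, 0 < d &
     forall t', cmod (t' - y0) <= r -> cmod (t' - t) < d -> cmod (g t' - g t) < e.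
  move=> tr e ep; have [e' [e'0 e'e e'eta]] := min2_gt0 ep e0.
  have [d' d'0 Hd'] := near_lift e'0.
  have [d2 [d20 d2d d2d']] := min2_gt0 d0 d'0.
  exists d2 => // t' t'r tt'.
  have [Eg Fg] := gF' _ tr; have [Eg' Fg'] := gF' _ t'r.
  have [|x' [Ex' Fx' hx']] := Hd' _ _ Eg t'r.
    by rewrite Fg cmodC (lt_le_trans tt').
  have -> : g t' = x'.
    apply: sep => //; first by rewrite Fg' Fx'.
    have := gc _ _ tr t'r (lt_le_trans tt' d2d).
    by have := cmod_tri (g t) (g t') x'; lra.
  by rewrite cmodC; lra.
(* Openness: for [x] close to [g t], the points [x] and [g (F x)] lie in the same fibre and both
   within [eta / 2] of [g t], hence coincide. *)
exists g; split=> // t tr.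
have [Eg Fg] := gF' _ (ltW tr).
have eta2 : 0 < eta / 2 by lra.
have [d1 d10 H1] := gcont _ (ltW tr) _ eta2.
have rt : 0 < r - cmod (t - y0) by lra.
have [d2 [d20 d2d1 d2r]] := min2_gt0 d10 rt.
have [d3 d30 H3] := sderiv_cont (sderiv_quotient P Eg.1) d20.
have [d4 d40 H4] := poly_neq0_near Eg.1.
have [d5 [d50 h3 h4]] := min2_gt0 d30 d40.
have [d6 [d60 h5 h6]] := min2_gt0 d50 eta2.
exists d6 => // x xg.
have := H3 x; rewrite -/(F x) -/(F (g t)) Fg => /(_ ltac:(lra)) Fx.
have Qx : Q.[x] != 0 by apply: H4; lra.
have Fxr : cmod (F x - y0) <= r by have := cmod_tri t (F x) y0; lra.
exists (F x) => //; have [EF FF] := gF' _ Fxr.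
apply: sep => //.
have := H1 _ Fxr (lt_le_trans Fx d2d1).
by have := cmod_tri (g t) (g (F x)) x; rewrite (cmodC (g t) x); lra.
Qed.

End Branch.

(** [G / Q] is the difference quotient of [P / Q] at [x], extended to [x] by the derivative. Both
    derivative bounds below come from it. *)
Lemma factor_value P Q x : Q.[x] != 0 -> exists G,
  P - (P.[x] / Q.[x]) *: Q = G * ('X - x%:P) /\ G.[x] / Q.[x] = (wronsk P Q).[x] / Q.[x] ^+ 2.
Proof.
move=> Qx; have /factor_theorem[G HG] : root (P - (P.[x] / Q.[x]) *: Q) x.
  by rewrite rootE !hornerE divfK // subrr.
exists G; split=> //.
have := congr1 (fun p : {poly C} => p^`().[x]) HG.
rewrite /= derivM derivB derivZ derivXsubC hornerD hornerN hornerZ hornerD !hornerM.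
rewrite hornerXsubC subrr mulr0 add0r hornerC mulr1 => <-.
by rewrite /wronsk hornerD hornerN !hornerM; field.
Qed.

(** The maximum principle is applied to [Q / (G * ('X - z1%:P))], whose value at [x0] is
    [1 / (F'(x0) (x0 - z1))]. On the boundary [(x - x0) / (x - z1) = 1 - (x0 - z1) / (x - z1)] has
    modulus at most [2 |x0 - z1| / e], where the 2 uses [e <= |x0 - z1|]. *)
Lemma branch_derivative_bound P Q y0 (r : R) x0 z1 (e : R) :
  proper_pair P Q -> 0 < r -> 0 < e -> Q.[x0] != 0 -> P.[x0] / Q.[x0] = y0 ->
  (forall x, Q.[x] != 0 -> cmod (P.[x] / Q.[x] - y0) <= r ->
     (wronsk P Q).[x] != 0 /\ e <= cmod (x - z1)) ->
  r * e <= 2 * cmod ((wronsk P Q).[x0] / Q.[x0] ^+ 2) * cmod (x0 - z1) ^+ 2.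
Proof.
move=> PQ r0 e0 Qx0 Fx0 H.
have [|g [g0 gF gc go]] := @inverse_branch P Q y0 r PQ _ x0 r0 Qx0 Fx0.
  by move=> x [Qx Fx]; have [] := H x Qx Fx.
have yr : cmod (y0 - y0) <= r by rewrite subrr cmod0 ltW.
have [W0 ex0] : (wronsk P Q).[x0] != 0 /\ e <= cmod (x0 - z1).
  by apply: H; rewrite ?Fx0.
have [G []] := factor_value P Qx0; rewrite Fx0 => GE GD.
have G0 : G.[x0] != 0.
  apply/eqP => G0; move: GD; rewrite G0 mul0r => /esym/eqP.
  by rewrite mulf_eq0 invr_eq0 expf_eq0 /= (negPf W0) (negPf Qx0).
have GF x : Q.[x] != 0 -> (P.[x] / Q.[x] - y0) * Q.[x] = G.[x] * (x - x0).
  move=> Qx; have := congr1 (fun p : {poly C} => p.[x]) GE.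
  by rewrite hornerM hornerXsubC hornerD hornerN hornerZ => <-; rewrite mulrBl divfK.
have gz t : cmod (t - y0) <= r -> g t - z1 != 0.
  move=> /gF[[Qg Fg] _]; rewrite -cmod_gt0; have [_] := H _ Qg Fg; lra.
(* A zero of [G] on the branch would have image [y0], hence be [x0] itself, where [G] is nonzero
   because [x0] is noncritical. *)
have Gg t : cmod (t - y0) <= r -> G.[g t] != 0.
  move=> tr; have [[Qg _] Fg] := gF _ tr; apply/eqP => Gt.
  have := GF _ Qg; rewrite Gt mul0r Fg => /eqP; rewrite mulf_eq0 (negPf Qg) orbF subr_eq0.
  by move=> /eqP tE; move: G0; rewrite -g0 -tE Gt eqxx.
have xz : x0 - z1 != 0 by rewrite -g0 gz.
have [|t tr] := @quotient_max_principle g Q (G * ('X - z1%:P)) y0 r r0 gc go.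
  by move=> t tr; rewrite hornerM hornerXsubC mulf_neq0 ?Gg ?gz.
have tr' : cmod (t - y0) <= r by rewrite tr.
have [[Qg Fg] Ft] := gF _ tr'.
rewrite g0 !hornerM !hornerXsubC.
have -> : Q.[g t] / (G.[g t] * (g t - z1)) = (t - y0)^-1 * ((g t - x0) / (g t - z1)).
  have t0 : t - y0 != 0 by rewrite -cmod_gt0 tr.
  have := GF _ Qg; rewrite Ft => h.
  have -> : Q.[g t] = (t - y0)^-1 * (G.[g t] * (g t - x0)) by rewrite -h mulKf.
  by field; rewrite t0 Gg // gz.
rewrite [leRHS]cmodM [cmod (t - y0)^-1]cmodV tr.
have -> : (g t - x0) / (g t - z1) = 1 - (x0 - z1) / (g t - z1).
  by field; rewrite gz.
have ez : e <= cmod (g t - z1) by have [] := H _ Qg Fg.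
have b1 : cmod (1 - (x0 - z1) / (g t - z1)) <= 2 * cmod (x0 - z1) / e.
  apply: le_trans (cmodD _ _) _; rewrite cmodN cmod1 cmodM cmodV.
  have : 1 <= cmod (x0 - z1) / e by rewrite ler_pdivlMr // mul1r.
  have : cmod (x0 - z1) / cmod (g t - z1) <= cmod (x0 - z1) / e.
    by rewrite ler_wpM2l ?cmod_ge0 // lef_pV2 ?posrE //; lra.
  lra.
rewrite -GD => h1.
have Gx : 0 < cmod G.[x0] by rewrite cmod_gt0.
have Qx : 0 < cmod Q.[x0] by rewrite cmod_gt0.
have cz : 0 < cmod (x0 - z1) by rewrite cmod_gt0.
have : cmod (Q.[x0] / (G.[x0] * (x0 - z1))) <= r^-1 * (2 * cmod (x0 - z1) / e).
  by apply: le_trans h1 _; rewrite ler_wpM2l // invr_ge0 ltW.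
rewrite !cmodM !cmodV cmodM ler_pdivrMr ?mulr_gt0 // => h2.
have := ler_wpM2r (ltW (mulr_gt0 r0 e0)) h2.
have -> : r^-1 * (2 * cmod (x0 - z1) / e) * (cmod G.[x0] * cmod (x0 - z1)) * (r * e) =
  2 * cmod G.[x0] * cmod (x0 - z1) ^+ 2.
  by field; rewrite !gt_eqF.
move=> h3; rewrite mulrA mulrAC ler_pdivlMr //; lra.
Qed.

(** A Cauchy estimate: the difference quotient [G / Q] is at most [K / d] on the circle of radius
    [d], and its value at the centre is the derivative. *)
Lemma schwarz_derivative_bound P Q x0 (d K : R) : 0 < d ->
  (forall u, cmod (u - x0) <= d -> Q.[u] != 0 /\
     cmod (P.[u] / Q.[u] - P.[x0] / Q.[x0]) <= K) ->
  cmod ((wronsk P Q).[x0] / Q.[x0] ^+ 2) * d <= K.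
Proof.
move=> d0 H.
have xd : cmod (x0 - x0) <= d by rewrite subrr cmod0 ltW.
have [Qx0 _] := H _ xd; have [G [GE <-]] := factor_value P Qx0.
have [||t td|t td] := @quotient_max_principle id G Q x0 d d0.
- by move=> t _ e e0; exists e.
- move=> t td; exists (d - cmod (t - x0)); first by rewrite subr_gt0.
  by move=> x xt; exists x => //; have := cmod_tri t x x0; lra.
- by have [] := H _ td.
have td' : cmod (t - x0) <= d by rewrite td.
have [Qt] := H _ td'.
have t0 : t - x0 != 0 by rewrite -cmod_gt0 td.
have -> : P.[t] / Q.[t] - P.[x0] / Q.[x0] = G.[t] / Q.[t] * (t - x0).
  have := congr1 (fun p : {poly C} => p.[t]) GE.
  rewrite hornerM hornerXsubC hornerD hornerN hornerZ => h.
  by rewrite [RHS]mulrAC -h; field; rewrite Qx0 Qt.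
rewrite cmodM td => h1 h2; apply: le_trans h1.
by rewrite ler_pM2r.
Qed.

End InverseBranch.

(** * Compositions *)


Section Composition.
Variable R : realType.
Local Notation C := R[i].
Implicit Types (x y z u v t D : C) (P Q G A B : {poly C}).
Implicit Types (f : {poly C} * {poly C}) (fs : seq ({poly C} * {poly C})).

(** This is [Q ^+ n * G (P / Q)] with denominators cleared. *)
Definition homogenize (n : nat) P Q G : {poly C} :=
  \sum_(i < n.+1) G`_i *: (P ^+ i * Q ^+ (n - i)).

Lemma horner_homogenize n P Q G x : (size G <= n.+1)%N -> Q.[x] != 0 ->
  (homogenize n P Q G).[x] = Q.[x] ^+ n * G.[P.[x] / Q.[x]].
Proof.
move=> sG Qx; rewrite (horner_coef_wide _ sG) mulr_sumr /homogenize horner_sum.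
apply: eq_bigr => i _; rewrite hornerZ hornerM !horner_exp expr_div_n.
have -> : Q.[x] ^+ n = Q.[x] ^+ (n - i) * Q.[x] ^+ i by rewrite -exprD subnK // -ltnS.
have : Q.[x] ^+ i != 0 by rewrite expf_neq0.
by move: (Q.[x] ^+ i) => a a0; field.
Qed.

Lemma horner_homogenize0 n P Q G x : Q.[x] = 0 ->
  (homogenize n P Q G).[x] = G`_n * P.[x] ^+ n.
Proof.
move=> Qx; rewrite /homogenize horner_sum big_ord_recr /= big1 ?add0r.
  by rewrite subnn expr0 mulr1 hornerZ horner_exp.
move=> i _; rewrite hornerZ hornerM !horner_exp Qx expr0n subn_eq0 leqNgt ltn_ord.
by rewrite !mulr0.
Qed.

Lemma size_homogenize_lower n P Q G : (size Q < size P)%N -> Q != 0 ->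
  (size (\sum_(i < n) G`_i *: (P ^+ i * Q ^+ (n - i)))%R <= (size P).-1 * n)%N.
Proof.
move=> sQP Q0; apply: leq_trans (size_sum _ _ _) _; apply/bigmax_leqP => i _.
apply: leq_trans (size_scale_leq _ _) _; apply: leq_trans (size_polyMleq _ _) _.
have := size_poly_exp_leq P i; have := size_poly_exp_leq Q (n - i).
have : (0 < size Q)%N by rewrite size_poly_gt0.
case: i => i /= ilt; set a := size (P ^+ i); set b := size (Q ^+ (n - i)).
move: (size P) (size Q) sQP => p q pq q0; clearbody a b => bq ap.
have [k nE] : exists k, n = (i + k.+1)%N by exists (n - i).-1; lia.
have [e [pE qe]] : exists e, p.-1 = e.+1 /\ (q.-1 <= e)%N by exists p.-1.-1; lia.
have ni : (n - i)%N = k.+1 by lia.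
have h : (q.-1 * k.+1 <= e * k.+1)%N by rewrite leq_mul2r qe orbT.
rewrite pE in ap *; rewrite ni in bq; rewrite nE mulnDr.
have -> : (e.+1 * k.+1 = e * k.+1 + k.+1)%N by rewrite mulSn addnC.
lia.
Qed.

(** Both polynomials are cleared by the same power [Q ^+ n] with [n] the degree of [A]. As [B] has
    smaller degree, its coefficient of index [n] is 0: so the new denominator vanishes at the poles
    of [P / Q], where the new numerator keeps its term in [P ^+ n], and it has smaller size than the
    numerator. *)
Lemma proper_comp P Q A B : proper_pair P Q -> proper_pair A B ->
  let n := (size A).-1 in
  proper_pair (homogenize n P Q A) (homogenize n P Q B) /\
  forall x, (homogenize n P Q B).[x] != 0 ->
    [/\ Q.[x] != 0, B.[P.[x] / Q.[x]] != 0 &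
      (homogenize n P Q A).[x] / (homogenize n P Q B).[x] =
      A.[P.[x] / Q.[x]] / B.[P.[x] / Q.[x]]].
Proof.
move=> PQ AB; have [sQP Q0 nz] := PQ; have [sBA B0 nzA] := AB.
move=> n; have sB : (0 < size B)%N by rewrite size_poly_gt0.
have sA : size A = n.+1 by rewrite /n prednK // (leq_ltn_trans _ sBA).
have sB' : (size B <= n.+1)%N by rewrite -sA ltnW.
have Bn : B`_n = 0 by rewrite nth_default // -ltnS -sA.
have An : A`_n != 0 by rewrite -[n]/(size A).-1 -lead_coefE lead_coef_eq0 -size_poly_gt0 sA.
have val x : (homogenize n P Q B).[x] != 0 ->
    [/\ Q.[x] != 0, B.[P.[x] / Q.[x]] != 0 &
      (homogenize n P Q A).[x] / (homogenize n P Q B).[x] =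
      A.[P.[x] / Q.[x]] / B.[P.[x] / Q.[x]]].
  have [Qx|Qx] := eqVneq Q.[x] 0.
    by rewrite horner_homogenize0 // Bn mul0r eqxx.
  rewrite !horner_homogenize ?sA // mulf_eq0 negb_or => /andP[_ Bx]; split=> //.
  have : Q.[x] ^+ n != 0 by rewrite expf_neq0.
  by move: (Q.[x] ^+ n) => a a0; field; rewrite a0 Bx.
split=> //; split.
- have lB := size_homogenize_lower n B sQP Q0.
  have lA := size_homogenize_lower n A sQP Q0.
  rewrite /homogenize !big_ord_recr /= Bn scale0r addr0.
  have P0 : P != 0 by rewrite -size_poly_gt0 (leq_ltn_trans _ sQP).
  have sT : size (A`_n *: (P ^+ n * Q ^+ (n - n))) = ((size P).-1 * n).+1.
    rewrite size_scale // subnn expr0 mulr1 -size_exp prednK //.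
    by rewrite size_poly_gt0 expf_neq0.
  by rewrite addrC size_polyDl sT ltnS.
- have [y] := closed_nonrootP B B0; rewrite rootE => By.
  have [x [Qx Fx _]] := proper_near_root 0 y PQ.
  apply/eqP => H0; have := congr1 (fun p : {poly C} => p.[x]) H0.
  rewrite /= horner0 horner_homogenize // Fx => /eqP.
  by rewrite mulf_eq0 (negPf By) orbF expf_eq0 (negPf Qx) andbF.
- move=> x; have [Qx|Qx] := eqVneq Q.[x] 0.
    by rewrite !horner_homogenize0 // => _; rewrite mulf_neq0 // expf_neq0 // nz.
  rewrite !horner_homogenize ?sA // => /eqP.
  rewrite mulf_eq0 expf_eq0 (negPf Qx) andbF /= => /eqP Bx.
  by rewrite mulf_neq0 ?expf_neq0 // nzA.
Qed.

(** A relation rather than a function, so that an orbit meeting a pole simply has no chain. The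
    chain rule is built in through [D], so orbits and derivatives are handled without expanding the
    composed polynomials. *)
Fixpoint chain fs x y D : Prop :=
  if fs is f :: fs' then
    f.2.[x] != 0 /\ exists2 D', chain fs' (f.1.[x] / f.2.[x]) y D' &
                      D = D' * ((wronsk f.1 f.2).[x] / f.2.[x] ^+ 2)
  else y = x /\ D = 1.

(** This lets the bounds for one rational map apply to compositions. The derivative of the folded
    quotient is identified by uniqueness of strict derivatives. *)
Lemma chain_proper_pair fs : (forall f, f \in fs -> proper_pair f.1 f.2) ->
  exists A B, [/\ proper_pair A B,
    forall x, B.[x] != 0 -> exists D, chain fs x (A.[x] / B.[x]) D &
    forall x y D, chain fs x y D ->
      [/\ B.[x] != 0, A.[x] / B.[x] = y & D = (wronsk A B).[x] / B.[x] ^+ 2]].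
Proof.
elim: fs => [|[P Q] fs IH] Hfs.
  exists 'X, 1; split.
  - by split; rewrite ?size_polyX ?size_poly1 ?oner_eq0 // => x /eqP; rewrite hornerC oner_eq0.
  - by move=> x _; exists 1; rewrite hornerX hornerC divr1.
  - move=> x y D /= [-> ->]; rewrite /wronsk derivX derivC mulr0 subr0 mulr1.
    by rewrite hornerX !hornerC oner_eq0 divr1 expr1n divr1.
have [A [B [AB exAB eqAB]]] := IH (fun f Hf => Hfs f (mem_behead (s := _ :: _) Hf)).
have PQ : proper_pair P Q by apply: (Hfs (P, Q)); rewrite inE eqxx.
have [cAB val] := proper_comp PQ AB.
set A1 := homogenize _ _ _ A in cAB val; set B1 := homogenize _ _ _ B in cAB val.
have der x D : B1.[x] != 0 -> Q.[x] != 0 -> B.[P.[x] / Q.[x]] != 0 ->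
   D = (wronsk A B).[P.[x] / Q.[x]] / B.[P.[x] / Q.[x]] ^+ 2 * ((wronsk P Q).[x] / Q.[x] ^+ 2) ->
   D = (wronsk A1 B1).[x] / B1.[x] ^+ 2.
  move=> B1x Qx Bx ->.
  apply: (@sderiv_unique _ (fun z => A1.[z] / B1.[z]) x); last exact: sderiv_quotient.
  have [d d0 Hd] := poly_neq0_near B1x.
  apply: (sderiv_ext d0); last exact: (sderiv_comp (sderiv_quotient P Qx) (sderiv_quotient A Bx)).
  by move=> u /Hd /val[_ _ ->].
have B1neq x : Q.[x] != 0 -> B.[P.[x] / Q.[x]] != 0 -> B1.[x] != 0.
  move=> Qx Bx; rewrite /B1 horner_homogenize // ?mulf_neq0 ?expf_neq0 //.
  by case: AB => /ltnW sBA _ _; apply: leq_trans sBA (leqSpred _).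
exists A1, B1; split=> //.
- move=> x B1x; have [Qx Bx ->] := val _ B1x.
  by have [D HD] := exAB _ Bx; exists (D * ((wronsk P Q).[x] / Q.[x] ^+ 2)); split=> //; exists D.
- move=> x y D /= [Qx [D' HD' ->]]; have [Bx ABy D'E] := eqAB _ _ _ HD'.
  have B1x := B1neq _ Qx Bx; have [_ _ vx] := val _ B1x.
  by split=> //; [rewrite vx|apply: der => //; rewrite D'E].
Qed.

Lemma chain_branch_bound fs x0 y0 D z1 (r e : R) :
  (forall f, f \in fs -> proper_pair f.1 f.2) -> 0 < r -> 0 < e ->
  chain fs x0 y0 D ->
  (forall x y D', chain fs x y D' -> cmod (y - y0) <= r -> D' != 0 /\ e <= cmod (x - z1)) ->
  r * e <= 2 * cmod D * cmod (x0 - z1) ^+ 2.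
Proof.
move=> /chain_proper_pair[A [B [AB exAB eqAB]]] r0 e0 c0 H.
have [B0 E0 ->] := eqAB _ _ _ c0.
apply: (@branch_derivative_bound _ A B y0) => // x Bx xr.
have [D' cD'] := exAB _ Bx; have [D'0 ex] := H _ _ _ cD' xr; split=> //.
apply: contraNneq D'0 => w0; have [_ _ ->] := eqAB _ _ _ cD'.
by rewrite w0 mul0r.
Qed.

Lemma chain_schwarz_bound fs x0 y0 D (d K : R) :
  (forall f, f \in fs -> proper_pair f.1 f.2) -> 0 < d -> chain fs x0 y0 D ->
  (forall u, cmod (u - x0) <= d -> exists y D', chain fs u y D' /\ cmod (y - y0) <= K) ->
  cmod D * d <= K.
Proof.
move=> /chain_proper_pair[A [B [AB exAB eqAB]]] d0 c0 H.
have [B0 E0 ->] := eqAB _ _ _ c0.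
apply: schwarz_derivative_bound => // u /H[y [D' [cD' yK]]].
by have [Bu Eu _] := eqAB _ _ _ cD'; rewrite E0 Eu.
Qed.

End Composition.

(** * The chordal metric *)


Section Chord.
Variable R : realType.
Local Notation C := R[i].
Implicit Types (x y z u v : C) (w : sphere R).

Lemma expr_lt_eventually (q e : R) : 0 <= q -> q < 1 -> 0 < e ->
  exists J : nat, forall j, (J <= j)%N -> q ^+ j < e.
Proof.
move=> q0 q1 e0; have qn : `|q| < 1 by rewrite ger0_norm.
have /cvgrPdist_lt/(_ _ e0)[J _ H] := cvg_expr qn.
exists J => j /H; rewrite /= sub0r normrN ger0_norm //.
exact: exprn_ge0.
Qed.

Lemma sqrt1_bounds x : 1 <= Num.sqrt (1 + cmod x ^+ 2) <= 1 + cmod x.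
Proof.
have c0 := cmod_ge0 x.
apply/andP; split.
  by rewrite -[leLHS]sqrtr1 ler_wsqrtr // lerDl exprn_ge0.
rewrite -[leRHS]ger0_norm ?addr_ge0 // -sqrtr_sqr ler_wsqrtr //.
by rewrite sqrrD expr1n mul1r lerD2r lerDl mulrn_wge0.
Qed.

Lemma chordC w w' : chord w w' = chord w' w.
Proof.
by case: w w' => [x|] [y|] //=; rewrite cmodC [in X in _ / X]mulrC.
Qed.

Lemma chord_le x y : chord (Some x) (Some y) <= 2 * cmod (x - y).
Proof.
rewrite /=; have /andP[x1 _] := sqrt1_bounds x; have /andP[y1 _] := sqrt1_bounds y.
have xy1 := mulr_ege1 x1 y1.
rewrite ler_pdivrMr; last exact: lt_le_trans xy1.
by rewrite ler_peMr // mulr_ge0 ?cmod_ge0.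
Qed.

Lemma chord_refl w : chord w w = 0.
Proof. by case: w => [x|] //=; rewrite subrr cmod0 mulr0 mul0r. Qed.

Lemma chord_near_finite (M e : R) : 0 <= M -> 0 < e -> exists2 d : R, 0 < d &
  forall x w, cmod x <= M -> chord (Some x) w < d ->
    exists2 y, w = Some y & cmod (y - x) < e.
Proof.
move=> M0 e0; have K0 : 0 <= (1 + M) ^+ 2 by rewrite sqr_ge0.
have [a [a0 _ aK]] := small_factor K0 e0.
have iM : 0 < (1 + M)^-1 by rewrite invr_gt0; lra.
(* With [t = |x - y|] the hypothesis gives [2 t < d (1 + M) (1 + M + t)]: the bound [d (1 + M) <= 1]
   absorbs one [t], and [d (1 + M)^2 <= e] bounds the rest. The former also excludes infinity. *)
have [d [d0 da dM]] := min2_gt0 a0 iM.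
have dM1 : d * (1 + M) <= 1 by rewrite -ler_pdivlMr ?mul1r //; lra.
exists d => // x [y|] xM /=; last first.
  have /andP[x1 x2] := sqrt1_bounds x.
  rewrite ltr_pdivrMr; last exact: lt_le_trans x1.
  move=> h; suff : 2 < 1 :> R by lra.
  apply: lt_le_trans h _; apply: le_trans dM1; rewrite ler_pM2l //; lra.
have /andP[x1 x2] := sqrt1_bounds x; have /andP[y1 y2] := sqrt1_bounds y.
have xy1 := mulr_ege1 x1 y1.
rewrite ltr_pdivrMr; last exact: lt_le_trans xy1.
move=> h; exists y => //; rewrite cmodC; set t := cmod (x - y) in h *.
have t0 : 0 <= t by exact: cmod_ge0.
have yt : cmod y <= M + t by have := cmodB_ge y x; rewrite cmodC -/t; lra.
have : 2 * t < d * ((1 + M) * (1 + M + t)).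
  apply: lt_le_trans h _; rewrite ler_pM2l //; apply: ler_pM; lra.
have : t * (d * (1 + M)) <= t by rewrite ler_piMr.
have : d * (1 + M) ^+ 2 <= a * (1 + M) ^+ 2 by rewrite ler_wpM2r.
rewrite expr2; lra.
Qed.

Lemma chord_near_infinity (M : R) : 0 <= M -> exists2 e : R, 0 < e &
  forall y, chord None (Some y) < e -> M < cmod y.
Proof.
move=> M0; exists (2 / (1 + M)); first by rewrite divr_gt0 //; lra.
move=> y /=; have /andP[y1 y2] := sqrt1_bounds y.
rewrite ltr_pM2l // ltf_pV2 ?posrE; [lra| |lra].
exact: lt_le_trans y1.
Qed.

Lemma chord_infinity_lt (d : R) : 0 < d -> exists y, chord None (Some y) < d.
Proof.
move=> d0; exists (2 / d)%:C%C; rewrite /chord; set s := Num.sqrt _.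
have cd : cmod (2 / d)%:C%C = 2 / d by rewrite cmod_real ger0_norm // divr_ge0 // ltW.
have s0 : 2 / d < s.
  rewrite -[ltLHS]ger0_norm ?divr_ge0 ?(ltW d0) // -sqrtr_sqr ltr_sqrt; last first.
    by rewrite ltr_pwDl // exprn_ge0 ?cmod_ge0.
  by rewrite cd ltrDr.
have s1 : 0 < s by apply: lt_trans s0; rewrite divr_gt0.
by rewrite ltr_pdivrMr // mulrC -ltr_pdivrMr.
Qed.

End Chord.

(** * Attracting dynamics *)


Section AttractingDynamics.
Variable R : realType.
Local Notation C := R[i].
Implicit Types (x y z u v a c D : C) (w : sphere R).

Variables (P Q : {poly C}) (f : sphere R -> sphere R) (Z : C -> Prop).
Hypothesis PQ : proper_pair P Q.
Hypothesis f_finite : forall x, f (Some x) = if Q.[x] == 0 then None else Some (P.[x] / Q.[x]).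
Hypothesis f_infinity : f None = None.
Variables (Rb rho : R).
Hypothesis Rb0 : 0 < Rb.
Hypothesis rho0 : 0 <= rho.
Hypothesis rho1 : rho < 1.
Hypothesis repelling_infinity : forall x, Rb < cmod x ->
  Q.[x] != 0 /\ cmod (P.[x] / Q.[x]) <= rho * cmod x.
Hypothesis attracting : forall z, Z z -> exists r lam : R,
  [/\ 0 < r, 0 <= lam, lam < 1 & forall x, cmod (x - z) <= r ->
     Q.[x] != 0 /\ cmod (P.[x] / Q.[x] - z) <= lam * cmod (x - z)].

Let F x := P.[x] / Q.[x].
Let crit c := Q.[c] != 0 /\ (wronsk P Q).[c] = 0.
Let iter_inf k : iter k f None = None.
Proof. by elim: k => //= k ->. Qed.

Lemma iter_finite_step k x y : iter k.+1 f (Some x) = Some y ->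
  Q.[x] != 0 /\ iter k f (Some (F x)) = Some y.
Proof.
rewrite iterSr f_finite; case: eqP => [_|/eqP Qx]; first by rewrite iter_inf.
by [].
Qed.

Lemma iter_step k x : Q.[x] != 0 -> iter k.+1 f (Some x) = iter k f (Some (F x)).
Proof. by move=> Qx; rewrite iterSr f_finite (negPf Qx). Qed.

Lemma iter_chain k x y : iter k f (Some x) = Some y <-> exists D, chain (nseq k (P, Q)) x y D.
Proof.
elim: k x => [|k IH] x.
  by split=> [[->]|[D /= [-> _]]] //; exists 1.
split=> [/iter_finite_step[Qx /IH[D cD]]|[D /= [Qx [D' cD' _]]]].
  by exists (D * ((wronsk P Q).[x] / Q.[x] ^+ 2)) => /=; split=> //; exists D.
by rewrite -iterS iter_step //; apply/IH; exists D'.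
Qed.

Lemma iter_cont N x (e : R) : iter N f (Some x) != None -> 0 < e ->
  exists2 d : R, 0 < d & forall k u, (k <= N)%N -> cmod (u - x) < d ->
    exists y y', [/\ iter k f (Some x) = Some y, iter k f (Some u) = Some y' &
      cmod (y - y') < e].
Proof.
move=> + e0; elim: N x => [|N IH] x xN.
  exists e => // k u; rewrite leqn0 => /eqP -> ux; exists x, u.
  by split=> //; rewrite cmodC.
have [Qx xN'] : Q.[x] != 0 /\ iter N f (Some (F x)) != None.
  case E: (iter N.+1 f (Some x)) xN => [y|] // _.
  by have [Qx ->] := iter_finite_step E.
have [d1 d10 H1] := IH _ xN'.
have [d2 d20 H2] := sderiv_cont (sderiv_quotient P Qx) d10.
have [d3 d30 H3] := poly_neq0_near Qx.
have [d4 [d40 h1 h2]] := min2_gt0 d20 d30.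
have [d [d0 h3 h4]] := min2_gt0 d40 e0.
exists d => // -[|k] u kN ux.
  by exists x, u; split=> //; rewrite cmodC (lt_le_trans ux).
have Qu : Q.[u] != 0 by apply: H3; lra.
have [|y [y' [E1 E2 lt]]] := H1 k (F u) kN; first by apply: H2; lra.
by exists y, y'; rewrite !iter_step.
Qed.

Lemma attracting_iter z (r lam : R) : 0 <= lam -> lam < 1 ->
  (forall x, cmod (x - z) <= r -> Q.[x] != 0 /\ cmod (F x - z) <= lam * cmod (x - z)) ->
  forall k x, cmod (x - z) <= r -> exists2 y, iter k f (Some x) = Some y &
    cmod (y - z) <= lam ^+ k * cmod (x - z).
Proof.
move=> l0 l1 H; elim=> [|k IH] x xr; first by exists x; rewrite ?expr0 ?mul1r.
have [Qx Fx] := H _ xr.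
have Fr : cmod (F x - z) <= r.
  apply: le_trans Fx _; apply: le_trans xr.
  by rewrite ler_piMl ?cmod_ge0 // ltW.
have [y yE yl] := IH _ Fr; exists y; first by rewrite iter_step.
apply: le_trans yl _; rewrite exprSr -mulrA ler_wpM2l // exprn_ge0 //.
Qed.

Lemma attracting_basin z (r lam : R) : 0 < r -> 0 <= lam -> lam < 1 ->
  (forall x, cmod (x - z) <= r -> Q.[x] != 0 /\ cmod (F x - z) <= lam * cmod (x - z)) ->
  forall k x w, iter k f w = Some x -> cmod (x - z) <= r -> basin f z w.
Proof.
move=> r0 l0 l1 H k x w wx xr e e0.
have q0 : 0 < e / (2 * r) / 2 by rewrite !divr_gt0 // mulr_gt0.
have [J HJ] := expr_lt_eventually l0 l1 q0.
exists (J + k)%N => n Jn.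
have -> : iter n f w = iter (n - k) f (Some x).
  by rewrite -wx -iterD subnK // (leq_trans (leq_addl _ _) Jn).
have [y -> yl] := attracting_iter l0 l1 H (n - k) xr.
apply: le_lt_trans (chord_le _ _) _.
have lJ : lam ^+ (n - k) < e / (2 * r) / 2 by apply: HJ; rewrite leq_subRL 1?addnC // (leq_trans (leq_addl _ _) Jn).
have : lam ^+ (n - k) * cmod (x - z) <= e / (2 * r) / 2 * r.
  by apply: ler_pM => //; rewrite ?cmod_ge0 ?exprn_ge0 // ltW.
have -> : e / (2 * r) / 2 * r = e / 4 by field; rewrite gt_eqF.
lra.
Qed.

Lemma basin_near z w (e : R) : basin f z w -> 0 < e ->
  exists k x, iter k f w = Some x /\ cmod (x - z) < e.
Proof.
move=> bz e0; have [d d0 H] := chord_near_finite (cmod_ge0 z) e0.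
have [K HK] := bz _ d0; have := HK _ (leqnn _); rewrite chordC.
by move=> /(H _ _ (lexx _))[y yE lt]; exists K, y.
Qed.

Lemma basin_near_eventually z w (e : R) : basin f z w -> 0 < e ->
  exists K, forall k, (K <= k)%N -> exists2 x, iter k f w = Some x & cmod (x - z) < e.
Proof.
move=> bz e0; have [d d0 H] := chord_near_finite (cmod_ge0 z) e0.
have [K HK] := bz _ d0; exists K => k /HK; rewrite chordC.
by move=> /(H _ _ (lexx _)).
Qed.

Lemma basin_unique z z' w : basin f z w -> basin f z' w -> z = z'.
Proof.
move=> b b'; apply/eqP; rewrite -subr_eq0 -cmod_eq0; apply: contraT => ne0.
have e0 : 0 < cmod (z - z') / 2 by rewrite divr_gt0 // lt0r ne0 cmod_ge0.
have [K HK] := basin_near_eventually b e0.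
have [K' HK'] := basin_near_eventually b' e0.
have [x E1 x1] := HK _ (leq_maxl K K'); have [x' E2 x2] := HK' _ (leq_maxr K K').
have xx : x = x' by move: E1; rewrite E2 => -[].
rewrite -xx in x2; have := cmod_tri x z z'; rewrite (cmodC z x); lra.
Qed.

Lemma basin_iter z k w : basin f z (iter k f w) -> basin f z w.
Proof.
move=> b e e0; have [K HK] := b _ e0; exists (K + k)%N => n Kn.
have := HK (n - k)%N; rewrite -iterD subnK; last exact: leq_trans (leq_addl _ _) Kn.
by apply; rewrite leq_subRL 1?addnC // (leq_trans (leq_addl _ _) Kn).
Qed.

Lemma basin_root z : Z z -> basin f z (Some z).
Proof.
case/attracting=> r [lam [r0 l0 l1 H]].
by apply: (attracting_basin r0 l0 l1 H (k := 0)) => //; rewrite subrr cmod0 ltW.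
Qed.

Lemma chain_critical k x y : chain (nseq k (P, Q)) x y 0 ->
  exists c j, crit c /\ iter j f (Some c) = Some y.
Proof.
elim: k x => [|k IH] x /=; first by case=> _ /esym/eqP; rewrite oner_eq0.
case=> Qx [D' cD' /esym/eqP]; rewrite mulf_eq0 => /orP[/eqP D'0|].
  by rewrite D'0 in cD'; exact: IH cD'.
rewrite mulf_eq0 invr_eq0 expf_eq0 (negPf Qx) andbF orbF => /eqP W0.
exists x, k.+1; split=> //; rewrite iter_step //; apply/iter_chain; by exists D'.
Qed.

(* Otherwise the inverse branches of the iterates fixing [z0] would all be defined
   on one disc and omit a neighbourhood of [z1], while their multipliers blow up. *)
Lemma basin_contains_critical z0 z1 : Z z0 -> Z z1 -> z0 != z1 ->
  exists2 c, crit c & basin f z0 (Some c).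
Proof.
move=> Z0 Z1 z01; apply: contrapT => nc.
have [r0 [lam [r00 l0 l1 H0]]] := attracting Z0.
have [r1 [lam1 [r10 l10 l11 H1]]] := attracting Z1.
have zz : 0 < cmod (z0 - z1) / 3 by rewrite divr_gt0 // cmod_gt0 subr_eq0.
have [r [rp rr0 rz]] := min2_gt0 r00 zz.
have [e [ep er1 ez]] := min2_gt0 r10 zz.
have zz2 : 0 < cmod (z0 - z1) ^+ 2 by rewrite exprn_gt0 //; lra.
(* Chosen so that [2 lam^J |z0 - z1|^2 < r e / 2], which contradicts the branch bound once the
   multiplier [D] of the [J]-th iterate satisfies [|D| <= lam^J]. *)
have q0 : 0 < r * e / (4 * cmod (z0 - z1) ^+ 2) by rewrite divr_gt0 // mulr_gt0.
have [J HJ] := expr_lt_eventually l0 l1 q0.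
have zr0 : cmod (z0 - z0) <= r0 by rewrite subrr cmod0 ltW.
have [y1 /iter_chain[D cD]] := attracting_iter l0 l1 H0 J zr0.
rewrite subrr cmod0 mulr0 => y10.
have yz : y1 = z0.
  by apply/eqP; rewrite -subr_eq0 -cmod_eq0 eq_le y10 cmod_ge0.
rewrite {y10}yz in cD.
have good g : g \in nseq J (P, Q) -> proper_pair g.1 g.2.
  by move=> /nseqP[-> _].
have Dl : cmod D * r <= lam ^+ J * r.
  apply: (chain_schwarz_bound good rp cD) => u ur.
  have ur0 : cmod (u - z0) <= r0 by exact: le_trans rr0.
  have [y /iter_chain[D' cD'] yl] := attracting_iter l0 l1 H0 J ur0.
  by exists y, D'; split=> //; apply: le_trans yl _; rewrite ler_wpM2l // exprn_ge0.
rewrite ler_pM2r // in Dl.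
have : r * e <= 2 * cmod D * cmod (z0 - z1) ^+ 2.
  apply: (chain_branch_bound good rp ep cD) => x y D' cD' yr; split.
    apply/eqP => D'0; rewrite {}D'0 in cD'; have [c [j [cc cy]]] := chain_critical cD'.
    apply: nc; exists c => //; apply: (attracting_basin r00 l0 l1 H0 cy).
    exact: le_trans rr0.
  (* A preimage [x] within [e] of [z1] would have its image within [e] of [z1] and within [r] of
     [z0], but [r] and [e] are at most a third of [|z0 - z1|]. *)
  rewrite leNgt; apply/negP => xe.
  have [|y' y'E yl] := attracting_iter l10 l11 H1 J (x := x).
    by apply: ltW; apply: lt_le_trans er1.
  have yE : iter J f (Some x) = Some y by apply/iter_chain; exists D'.
  move: y'E; rewrite yE => -[yy']; rewrite -{}yy' in yl.
  have : lam1 ^+ J * cmod (x - z1) <= cmod (x - z1).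
    by rewrite ler_piMl ?cmod_ge0 // exprn_ile1 // ltW.
  have := cmod_tri y z0 z1; rewrite (cmodC z0 y); lra.
have := HJ _ (leqnn J); rewrite ltr_pdivlMr; last by rewrite mulr_gt0.
move=> h.
have : cmod D * cmod (z0 - z1) ^+ 2 <= lam ^+ J * cmod (z0 - z1) ^+ 2.
  by rewrite ler_pM2r.
have : 0 < r * e by rewrite mulr_gt0.
lra.
Qed.

Lemma basin_open z x : Z z -> basin f z (Some x) -> exists2 d : R, 0 < d &
  forall u, cmod (u - x) < d -> basin f z (Some u).
Proof.
move=> Zz b; have [r [lam [r0 l0 l1 H]]] := attracting Zz.
have r2 : 0 < r / 2 by rewrite divr_gt0.
have [k [y [yE yz]]] := basin_near b r2.
have [|d d0 Hd] := iter_cont (N := k) (x := x) _ r2; first by rewrite yE.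
exists d => // u /(Hd k u (leqnn _))[y1 [y2 [E1 E2 lt]]].
apply: (attracting_basin r0 l0 l1 H E2).
move: E1; rewrite yE => -[yy]; rewrite -yy in lt.
by have := cmod_tri y y2 z; rewrite (cmodC y2 y); lra.
Qed.

(** The first [J + k] iterates are handled by continuity; afterwards both orbits stay within [e / 8]
    of [z]. *)
Lemma basin_equicont z x : Z z -> basin f z (Some x) -> iter_equicont f (Some x).
Proof.
move=> Zz b e e0; have [r [lam [r0 l0 l1 H]]] := attracting Zz.
have r2 : 0 < r / 2 by rewrite divr_gt0.
have [k [y [yE yz]]] := basin_near b r2.
have q0 : 0 < e / (8 * r) by rewrite divr_gt0 // mulr_gt0.
have [J HJ] := expr_lt_eventually l0 l1 q0.
have e4 : 0 < e / 4 by rewrite divr_gt0.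
have [d1 [d10 d1r d1e]] := min2_gt0 r2 e4.
have yr : cmod (y - z) <= r by lra.
have [yJ yJE _] := attracting_iter l0 l1 H J yr.
have [|d d0 Hd] := iter_cont (N := (J + k)%N) (x := x) _ d10.
  by rewrite iterD yE yJE.
have [d' d'0 Hd'] := chord_near_finite (cmod_ge0 x) d0.
exists d' => // n w /(Hd' _ _ (lexx _))[u -> ux].
have [nJ|/ltnW Jn] := leqP n (J + k).
  have [y1 [y2 [-> -> lt]]] := Hd _ _ nJ ux.
  by apply: le_lt_trans (chord_le _ _) _; lra.
have [y1 [y2 [E1 E2 lt]]] := Hd _ _ (leq_addl J k) ux.
move: E1; rewrite yE => -[yy]; rewrite -{}yy in lt.
have y2r : cmod (y2 - z) <= r by have := cmod_tri y y2 z; rewrite (cmodC y2 y); lra.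
have kn : (k <= n)%N := leq_trans (leq_addl _ _) Jn.
have split v' : iter n f (Some v') = iter (n - k) f (iter k f (Some v')).
  by rewrite -iterD subnK.
rewrite !split yE E2.
have [a -> al] := attracting_iter l0 l1 H (n - k) yr.
have [b' -> bl] := attracting_iter l0 l1 H (n - k) y2r.
apply: le_lt_trans (chord_le _ _) _.
have lJ : lam ^+ (n - k) < e / (8 * r) by apply: HJ; rewrite leq_subRL 1?addnC.
have bnd s : 0 <= s -> s <= r -> lam ^+ (n - k) * s <= e / 8.
  move=> s0 sr; have -> : e / 8 = e / (8 * r) * r by field; rewrite gt_eqF.
  by apply: ler_pM => //; rewrite ?exprn_ge0 // ltW.
have := bnd _ (cmod_ge0 _) yr; have := bnd _ (cmod_ge0 _) y2r.
by have := cmod_tri z a b'; rewrite (cmodC z b'); lra.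
Qed.

Lemma basin_finite z w : basin f z w -> exists x, w = Some x.
Proof.
case: w => [x|] b; first by exists x.
by have [k [x []]] := basin_near b ltr01; rewrite iter_inf.
Qed.

Lemma basin_fatou z w : Z z -> basin f z w -> fatou f w.
Proof.
move=> Zz b; have [x wx] := basin_finite b; rewrite {}wx in b *.
have [d d0 Hd] := basin_open Zz b.
have [d' d'0 Hd'] := chord_near_finite (cmod_ge0 x) d0.
exists d' => // w' /(Hd' _ _ (lexx _))[u -> /Hd bu].
exact: basin_equicont bu.
Qed.

(** The margin [d] is the point: if [F x] lies outside [A], then [x] is at distance at least [d]
    from [A]. It survives small perturbations of the map. *)
Definition trap (A : C -> Prop) :=
  [/\ exists M : R, forall a, A a -> cmod a <= M,
      exists2 d : R, 0 < d & forall a x, A a -> cmod (x - a) < d -> Q.[x] != 0 /\ A (F x)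
    & forall a, A a -> exists2 z, Z z & basin f z (Some a)].

(** Induction on the time needed to reach the attracting disc of [z]: a small disc around [c] mapped
    into the trap of [F c] is added to that trap. *)
Lemma trap_near z c : Z z -> basin f z (Some c) -> exists A : C -> Prop, trap A /\
  exists2 d : R, 0 < d & forall x, cmod (x - c) < d -> A x.
Proof.
move=> Zz b; have [r [lam [r0 l0 l1 H]]] := attracting Zz.
have [k [y [yE yz]]] := basin_near b r0.
elim: k c b yE => [|k IH] c b yE.
  move: yE => [cy]; rewrite -{y}cy in yz.
  have lr : lam * r < r by rewrite gtr_pMl.
  (* Any radius strictly between [max |c - z| (lam r)] and [r] works: the disc contains [c], and its
     neighbourhood of width [r - s] is sent within [lam r < s] of [z]. *)
  pose s := (Num.max (cmod (c - z)) (lam * r) + r) / 2.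
  have mr : Num.max (cmod (c - z)) (lam * r) < r by rewrite gt_max yz lr.
  have cm : cmod (c - z) <= Num.max (cmod (c - z)) (lam * r) by rewrite le_max lexx.
  have lm : lam * r <= Num.max (cmod (c - z)) (lam * r) by rewrite le_max lexx orbT.
  have sr : s < r by rewrite /s; lra.
  have cs : cmod (c - z) < s by rewrite /s; lra.
  have ls : lam * r < s by rewrite /s; lra.
  exists (fun a => cmod (a - z) < s); split; last first.
    exists (s - cmod (c - z)); first by rewrite subr_gt0.
    by move=> x xc; have := cmod_tri c x z; lra.
  split.
  - by exists (s + cmod z) => a az; have := cmodB_ge a z; lra.
  - exists (r - s); first by rewrite subr_gt0.
    move=> a x az xa; have xr : cmod (x - z) <= r by have := cmod_tri a x z; lra.
    have [Qx Fx] := H _ xr; split=> //.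
    have : lam * cmod (x - z) <= lam * r by rewrite ler_wpM2l.
    by rewrite /F; lra.
  - move=> a az; exists z => //.
    by apply: (attracting_basin r0 l0 l1 H (k := 0)) => //; lra.
have [Qc cE] := iter_finite_step yE.
have bF : basin f z (Some (F c)) by exact: (attracting_basin r0 l0 l1 H cE (ltW yz)).
have [A [[[M AM] [d1 d10 A1] Ab] [d2 d20 A2]]] := IH _ bF cE.
have [d3 d30 H3] := sderiv_cont (sderiv_quotient P Qc) d20.
have [d4 d40 H4] := poly_neq0_near Qc.
have [d5 [d50 h1 h2]] := min2_gt0 d30 d40.
have step x : cmod (x - c) < d5 -> Q.[x] != 0 /\ A (F x).
  by move=> xc; split; [apply: H4; lra | apply: A2; apply: H3; lra].
(* Only half the radius is added, so that a neighbourhood of the new disc is still mapped into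
   [A]. *)
exists (fun a => cmod (a - c) < d5 / 2 \/ A a); split; last first.
  by exists (d5 / 2) => [|x]; [rewrite divr_gt0|left].
split.
- exists (Num.max M (cmod c + d5)) => a [ac|/AM aM]; rewrite le_max; last by rewrite aM.
  by apply/orP; right; have := cmodB_ge a c; lra.
- have d52 : 0 < d5 / 2 by rewrite divr_gt0.
  have [d [d0 dd1 dd5]] := min2_gt0 d10 d52.
  exists d => // a x [ac|Aa] xa.
    have [|Qx AF] := step x; first by have := cmod_tri a x c; lra.
    by split=> //; right.
  have [|Qx AF] := A1 _ x Aa; first by lra.
  by split=> //; right.
- move=> a [ac|/Ab//]; have [|Qa AF] := step a; first by lra.
  have [z' Zz' bz'] := Ab _ AF; exists z' => //; apply: (basin_iter (k := 1)).
  by rewrite /= f_finite (negPf Qa).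
Qed.

Lemma trap_seq (cs : seq C) :
  (forall c, c \in cs -> exists2 z, Z z & basin f z (Some c)) ->
  exists A : C -> Prop, trap A /\ forall c, c \in cs -> A c.
Proof.
elim: cs => [|c cs IH] Hcs.
  exists (fun=> False); split=> //; split=> //; first by exists 0.
  by exists 1.
have [|A [[[M AM] [d d0 Ad] Ab] Acs]] := IH.
  by move=> x xcs; apply: Hcs; rewrite inE xcs orbT.
have [z Zz bz] := Hcs _ (mem_head _ _).
have [B [[[M' BM] [d' d'0 Bd] Bb] [e e0 Bc]]] := trap_near Zz bz.
exists (fun a => A a \/ B a); split; last first.
  move=> x; rewrite inE => /orP[/eqP ->|/Acs]; last by left.
  by right; apply: Bc; rewrite subrr cmod0.
split.
- by exists (Num.max M M') => a [/AM|/BM] h; rewrite le_max h ?orbT.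
- have [m [m0 md md']] := min2_gt0 d0 d'0; exists m => // a x [Aa|Ba] xa.
    by have [|Qx AF] := Ad _ x Aa; [lra|split=> //; left].
  by have [|Qx AF] := Bd _ x Ba; [lra|split=> //; right].
- by move=> a [/Ab|/Bb].
Qed.

(** Otherwise [P' Q = P Q'], and coprimality makes [Q] divide [Q'], so [Q' = 0] by degree and then
    [P' = 0]. This makes the critical set finite. *)
Lemma wronsk_neq0 : wronsk P Q != 0.
Proof.
have [sQP Q0 nz] := PQ; apply/eqP => /eqP; rewrite /wronsk subr_eq0 => /eqP W.
have cop : coprimep Q P.
  by apply: Pdiv.ClosedField.root_coprimep => x /rootP; exact: nz.
have QQ' : Q %| Q^`() by rewrite -(Gauss_dvdpr _ cop) -W dvdp_mull.
have Q'0 : Q^`() = 0.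
  apply/eqP; apply: contraT => Q'0; have := dvdp_leq Q'0 QQ'.
  by rewrite leqNgt lt_size_deriv.
move: W; rewrite Q'0 mulr0 => /eqP; rewrite mulf_eq0 (negPf Q0) orbF; apply/negP.
by rewrite deriv_neq0 // (leq_ltn_trans _ sQP) // size_poly_gt0.
Qed.

Lemma nonroot_near (B : {poly C}) x (d : R) : B != 0 -> 0 < d ->
  exists2 u, cmod (u - x) < d & B.[u] != 0.
Proof.
move=> B0 d0; have [k [B1]] := multiplicity_XsubC B x; rewrite B0 /= rootE => B1x BE.
have [d1 d10 H1] := poly_neq0_near B1x.
have [d2 [d20 d2d d2d1]] := min2_gt0 d0 d10.
have cd : cmod (x + (d2 / 2)%:C%C - x) = d2 / 2.
  by rewrite addrC addKr cmod_real ger0_norm // divr_ge0 // ltW.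
exists (x + (d2 / 2)%:C%C); first by rewrite cd; lra.
rewrite BE hornerM horner_exp hornerXsubC mulf_neq0 //; first by apply: H1; rewrite cd; lra.
by rewrite expf_neq0 // -cmod_gt0 cd; lra.
Qed.

(** Infinity repels. Equicontinuity would keep the later iterates of a nearby point outside the disc
    of radius [Rb], where each step multiplies the modulus by at most [rho < 1]; this cannot
    last. *)
Lemma equicont_avoids_infinity w k : iter_equicont f w -> iter k f w <> None.
Proof.
move=> eq wk; have [e e0 He] := chord_near_infinity (ltW Rb0).
have [d d0 Hd] := eq _ e0.
(* For finite [w] the denominator of the [k]-th iterate is a nonzero polynomial, so some [u] close
   to [w] has a finite [k]-th iterate; for infinite [w] a large finite point serves at time 0. *)
have [j [u [wj wu [v uv]]]] : exists j (u : sphere R), [/\ iter j f w = None, chord w u < d &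
    exists v, iter j f u = Some v].
  case: w wk {eq Hd} => [x|] wk; last first.
    have [y yd] := chord_infinity_lt d0; exists 0%N, (Some y); split=> //.
    by exists y.
  have good g : g \in nseq k (P, Q) -> proper_pair g.1 g.2 by move=> /nseqP[-> _].
  have [A [B [[_ B0 _] exAB _]]] := chain_proper_pair good.
  have d4 : 0 < d / 4 by rewrite divr_gt0.
  have [u ux Bu] := nonroot_near x B0 d4.
  exists k, (Some u); split=> //.
    by apply: le_lt_trans (chord_le _ _) _; rewrite cmodC; lra.
  by exists (A.[u] / B.[u]); apply/iter_chain; exact: exAB.
have far n : exists2 y, iter (n + j) f u = Some y & Rb < cmod y /\ cmod y <= rho ^+ n * cmod v.
  elim: n => [|n [y yE [yR yv]]].
    exists v => //; rewrite expr0 mul1r lexx; split=> //; apply: He.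
    by have := Hd j _ wu; rewrite wj uv.
  have [Qy Fy] := repelling_infinity yR.
  have yE' : iter (n.+1 + j) f u = Some (F y).
    by rewrite addSn iterS yE f_finite (negPf Qy).
  exists (F y) => //; split.
    apply: He; have := Hd (n.+1 + j)%N _ wu; rewrite yE' iterD wj.
    by rewrite iter_inf.
  by apply: le_trans Fy _; rewrite exprS -mulrA ler_wpM2l.
have v0 : 0 < cmod v.
  have [y _ [yR]] := far 0%N; rewrite expr0 mul1r => yv.
  exact: lt_trans Rb0 (lt_le_trans yR yv).
have q0 : 0 < Rb / cmod v by rewrite divr_gt0.
have [J HJ] := expr_lt_eventually rho0 rho1 q0.
have [y _ [yR yv]] := far J; have := HJ _ (leqnn _).
by rewrite ltr_pdivlMr //; lra.
Qed.

(** As long as the orbit stays outside the disc, its moduli decay geometrically. *)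
Lemma orbit_returns x : (forall k, iter k f (Some x) <> None) ->
  exists2 k, (0 < k)%N & exists2 y, iter k f (Some x) = Some y & cmod y <= Rb.
Proof.
move=> fin; apply: contrapT => nret.
have orb k : exists y, iter k f (Some x) = Some y.
  by case E: (iter k f (Some x)) (fin k) => [y|] // _; exists y.
have [v vE] := orb 1%N.
have large k y : iter k.+1 f (Some x) = Some y -> Rb < cmod y.
  move=> yE; rewrite ltNge; apply/negP => le; apply: nret.
  by exists k.+1 => //; exists y.
have far n y : iter n.+1 f (Some x) = Some y -> cmod y <= rho ^+ n * cmod v.
  elim: n y => [|n IH] y yE.
    by move: yE; rewrite vE => -[<-]; rewrite expr0 mul1r.
  have [u uE] := orb n.+1; have [Qu Fu] := repelling_infinity (large _ _ uE).
  move: yE; rewrite iterS uE f_finite (negPf Qu) => -[<-].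
  by apply: le_trans Fu _; rewrite exprS -mulrA ler_wpM2l // IH.
have v0 : 0 < cmod v := lt_trans Rb0 (large _ _ vE).
have q0 : 0 < Rb / cmod v by rewrite divr_gt0.
have [J HJ] := expr_lt_eventually rho0 rho1 q0.
have [y yE] := orb J.+1; have := HJ _ (leqnn J).
by have := far _ _ yE; have := large _ _ yE; rewrite ltr_pdivlMr //; lra.
Qed.

(* Composing with a contraction of ratio [k] centred at the current orbit point
   keeps the orbit but multiplies the derivative along it by [k]. The perturbed
   compositions obey the same distortion bound as the iterates of [f], which
   therefore gain a factor [k^-1] at each visit to the disc of radius [Rb]. *)
Definition contracted_step (k : R) y : {poly C} * {poly C} :=
  let s := (if cmod y <= Rb then k else 1)%:C%C in (s *: P + ((1 - s) * y) *: Q, Q).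

Fixpoint contracted_orbit (k : R) n x :=
  if n is n'.+1 then contracted_step k (F x) :: contracted_orbit k n' (F x) else [::].

(** Images are counted and not the starting point, in accordance with the centres of
    [contracted_orbit]. *)
Fixpoint returns n x : nat :=
  if n is n'.+1 then ((cmod (F x) <= Rb)%R + returns n' (F x))%N else 0%N.

Lemma contracted_step_wronsk k y : wronsk (contracted_step k y).1 (contracted_step k y).2 =
  (if cmod y <= Rb then k else 1)%:C%C *: wronsk P Q.
Proof.
rewrite /wronsk /= derivD !derivZ -!mul_polyC; ring.
Qed.

Lemma contracted_step_proper k y : 0 < k ->
  proper_pair (contracted_step k y).1 (contracted_step k y).2.
Proof.
move=> k0; have [sQP Q0 nz] := PQ; rewrite /contracted_step /=; set s := _%:C%C.
have s0 : s != 0.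
  by rewrite /s -cmod_gt0 cmod_real normr_gt0; case: ifP => _; rewrite ?oner_eq0 // gt_eqF.
split=> //; last first.
  by move=> x Qx; rewrite hornerD !hornerZ Qx mulr0 addr0 mulf_neq0 // nz.
have lt : (size (((1 - s) * y) *: Q) < size (s *: P))%N.
  by rewrite (size_scale _ s0); exact: leq_ltn_trans (size_scale_leq _ _) sQP.
by rewrite size_polyDl // size_scale.
Qed.

Lemma contracted_orbit_proper k n x : 0 < k -> forall g, g \in contracted_orbit k n x ->
  proper_pair g.1 g.2.
Proof.
move=> k0; elim: n x => [//|n IH] x g /=.
rewrite inE => /orP[/eqP ->|/IH//]; exact: contracted_step_proper.
Qed.

Lemma contracted_orbit_chain k n x y D : 0 < k -> chain (nseq n (P, Q)) x y D ->
  exists2 D', chain (contracted_orbit k n x) x y D' & cmod D' = cmod D * k ^+ returns n x.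
Proof.
move=> k0; elim: n x y D => [|n IH] x y D.
  by move=> /= [-> ->]; exists 1 => //; rewrite expr0 mulr1.
case=> Qx [D1 cD1 ->]; have [D2 cD2 D2E] := IH _ _ _ cD1.
pose s := (if cmod (F x) <= Rb then k else 1)%:C%C.
exists (D2 * (s * ((wronsk P Q).[x] / Q.[x] ^+ 2))).
  split=> //; exists D2.
    have -> // : (contracted_step k (F x)).1.[x] / (contracted_step k (F x)).2.[x] = F x.
    by rewrite /contracted_step /= hornerD !hornerZ -/s /F; field.
  by rewrite contracted_step_wronsk hornerZ -/s -mulrA.
rewrite !cmodM D2E /s cmod_real /returns -/returns exprD.
case: ifP => _; rewrite ?expr1 ?expr0.
  by rewrite gtr0_norm //; ring.
by rewrite normr1; ring.
Qed.

(** Were [F u] in [A], the contraction would move it by at most [(1 - k) (Rb + M) < d], and the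
    perturbed value would be closer than [d] to [A]. So [F u] is outside [A], and therefore [u] is
    noncritical and [d]-far from [A]. The induction runs backwards from the end of the chain. *)
Lemma contracted_orbit_avoids k n x u v D (A : C -> Prop) (d M : R) :
  0 < k -> k <= 1 -> 0 < d -> (forall a, A a -> cmod a <= M) -> (1 - k) * (Rb + M) < d ->
  (forall a x, A a -> cmod (x - a) < d -> Q.[x] != 0 /\ A (F x)) ->
  (forall c, crit c -> A c) ->
  chain (contracted_orbit k n x) u v D -> (forall a, A a -> d <= cmod (v - a)) ->
  D != 0 /\ forall a, A a -> d <= cmod (u - a).
Proof.
move=> k0 k1 d0 AM kM Ad Ac; elim: n x u v D => [|n IH] x u v D.
  by move=> [-> ->] H; split=> //; exact: oner_neq0.
case=> Qu [D' /IH{}IH ->] far; have [D'0 u1far] := IH far.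
rewrite -[(contracted_step k (F x)).2]/Q in Qu *.
have nAF : ~ A (F u).
  move=> AF; have := u1far _ AF; apply/negP; rewrite -ltNge.
  rewrite /contracted_step /=; set s := _%:C%C.
  have -> : (s *: P + ((1 - s) * F x) *: Q).[u] / Q.[u] - F u = (1 - s) * (F x - F u).
    by rewrite hornerD !hornerZ; move: (F x) => b; rewrite /F; field.
  rewrite cmodM /s; case: ifP => [FR|_]; last by rewrite subrr cmod0 mul0r.
  have -> : 1 - k%:C%C = (1 - k)%:C%C :> C by rewrite rmorphB rmorph1.
  rewrite cmod_real ger0_norm ?subr_ge0 //.
  apply: le_lt_trans kM; rewrite ler_wpM2l ?subr_ge0 //.
  by have := cmodD (F x) (- F u); have := AM _ AF; rewrite cmodN; lra.
split.
  rewrite contracted_step_wronsk hornerZ !mulf_neq0 ?invr_eq0 ?expf_neq0 //.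
    by rewrite -cmod_gt0 cmod_real normr_gt0; case: ifP => _; rewrite ?oner_eq0 // gt_eqF.
  apply/eqP => W0; apply: nAF; have Au : A u by apply: Ac.
  by have [|_] := Ad _ u Au; rewrite ?subrr ?cmod0.
move=> a Aa; rewrite leNgt; apply/negP => lt; apply: nAF.
by have [] := Ad _ u Aa lt.
Qed.

Lemma returns_unbounded x m : (forall k, iter k f (Some x) <> None) ->
  exists n, exists2 y, iter n f (Some x) = Some y & cmod y <= Rb /\ (m < returns n x)%N.
Proof.
have returnsD n n' x' y : iter n f (Some x') = Some y ->
    returns (n + n') x' = (returns n x' + returns n' y)%N.
  elim: n x' => [|n IH] x'; first by case=> ->.
  by move=> /iter_finite_step[_ /IH H]; rewrite addSn /= H addnA.
have returns_pos n x' y : (0 < n)%N -> iter n f (Some x') = Some y -> cmod y <= Rb ->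
    (0 < returns n x')%N.
  case: n => // n _; elim: n x' => [|n IH] x'.
    by move=> /iter_finite_step[_ [<-]] /= ->.
  by move=> /iter_finite_step[_ /IH H] /H h; apply: leq_trans h _; rewrite /= leq_addl.
move=> fin; elim: m => [|m [n [y yE [yR mn]]]].
  have [k k0 [y yE yR]] := orbit_returns fin.
  by exists k, y => //; split=> //; exact: returns_pos yE yR.
have [|k k0 [y' y'E y'R]] := @orbit_returns y.
  by move=> k; rewrite -yE -iterD; exact: fin.
exists (n + k)%N, y'; first by rewrite addnC iterD yE.
by split=> //; rewrite (returnsD _ _ _ _ yE) -addn1 leq_add // (returns_pos _ _ _ k0 y'E).
Qed.

Lemma fatou_basin z1 w : Z z1 ->
  (forall c, crit c -> exists2 z, Z z & basin f z (Some c)) ->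
  fatou f w -> exists2 z, Z z & basin f z w.
Proof.
move=> Z1 critZ [r r0 Hw]; apply: contrapT => nb.
have eqw : iter_equicont f w by apply: Hw; rewrite chord_refl.
have fin k : iter k f w <> None by exact: equicont_avoids_infinity.
case: w {Hw} nb eqw fin => [x|]; last by move=> _ _ /(_ 0%N).
move=> nb eqx fin.
have [cs Wcs] := closed_field_poly_normal (wronsk P Q).
have csP c : crit c -> c \in cs.
  case=> Qc /rootP; rewrite Wcs rootZ ?lead_coef_eq0 ?wronsk_neq0 //.
  by rewrite root_prod_XsubC.
(* The point [z1] is added to the critical points to provide the centre of the omitted disc. *)
have [|A [[[M AM] [d d0 Ad] Ab] Acs]] := @trap_seq (z1 :: [seq c <- cs | (Q.[c] != 0) && root (wronsk P Q) c]).
  move=> c; rewrite inE => /orP[/eqP ->|]; first by exists z1 => //; exact: basin_root.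
  by rewrite mem_filter => /andP[/andP[Qc /rootP Wc] _]; exact: critZ.
have Az1 : A z1 by apply: Acs; rewrite inE eqxx.
have Ac c : crit c -> A c.
  move=> cc; apply: Acs; rewrite inE mem_filter (csP _ cc) andbT.
  by case: cc => -> /rootP ->; rewrite orbT.
have M0 : 0 <= M by apply: le_trans (AM _ Az1); exact: cmod_ge0.
have d2 : 0 < d / 2 by rewrite divr_gt0.
have d4 : 0 < d / 4 by rewrite divr_gt0.
have [t [t0 t1 tM]] := small_factor (addr_ge0 (ltW Rb0) M0) d4.
pose k := 1 - t / 2.
have k0 : 0 < k by rewrite /k; lra.
have k1 : k < 1 by rewrite /k; lra.
have kM : (1 - k) * (Rb + M) < d / 2.
  have -> : (1 - k) * (Rb + M) = t * (Rb + M) / 2 by rewrite /k; field.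
  lra.
have [d1 d10 Hd1] := chord_near_finite (ltW Rb0) ltr01.
have [s4 s40 Hs] := eqx _ d10.
have s0 : 0 < s4 / 4 by rewrite divr_gt0.
set s := s4 / 4 in s0.
set X := cmod (x - z1) ^+ 2.
have X0 : 0 <= X by rewrite /X exprn_ge0 ?cmod_ge0.
(* The branch bound will read [(d/2)^2 <= 2 |D| k^returns X] with [|D| <= 1 / s]. This threshold
   makes the right side at most half the left one; the 1 added to [X] keeps the denominator
   positive. *)
have q0 : 0 < d / 2 * (d / 2) * s / (4 * (X + 1)).
  by rewrite divr_gt0 ?mulr_gt0 //; lra.
have [m Hm] := expr_lt_eventually (ltW k0) k1 q0.
have [n [y yE [yR mn]]] := returns_unbounded m fin.
have [D cD] := (iter_chain n x y).1 yE.
have good g : g \in nseq n (P, Q) -> proper_pair g.1 g.2 by move=> /nseqP[-> _].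
(* Upper bound on the derivative: by equicontinuity the disc of radius [s] around [x] is sent within
   distance 1 of [y]. The choice of [d1] is uniform because the return [y] satisfies [|y| <= Rb]. *)
have Ds : cmod D * s <= 1.
  apply: (chain_schwarz_bound good s0 cD) => u us.
  have := Hs n (Some u); rewrite yE.
  have xu : chord (Some x) (Some u) < s4.
    by apply: le_lt_trans (chord_le _ _) _; move: us; rewrite cmodC /s; lra.
  move=> /(_ xu) /(Hd1 _ _ yR)[v vE vy].
  by have [D' cD'] := (iter_chain n u v).1 vE; exists v, D'; split=> //; exact: ltW.
have Qy : Q.[y] != 0.
  by apply/eqP => Qy; have := fin n.+1; rewrite iterS yE f_finite Qy eqxx.
have nAF : ~ A (F y).
  move=> /Ab[z Zz bz]; apply: nb; exists z => //; apply: (basin_iter (k := n.+1)).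
  by rewrite iterS yE f_finite (negPf Qy).
have yfar a : A a -> d <= cmod (y - a).
  move=> Aa; rewrite leNgt; apply/negP => lt; apply: nAF.
  by have [] := Ad _ y Aa lt.
(* Half of the margin is spent on the disc of radius [d / 2] around [y], the other half on the
   contractions. *)
have Ad2 a x' : A a -> cmod (x' - a) < d / 2 -> Q.[x'] != 0 /\ A (F x').
  by move=> Aa lt; apply: Ad Aa _; lra.
have [D' cD' D'E] := contracted_orbit_chain k0 cD.
have : d / 2 * (d / 2) <= 2 * cmod D' * X.
  apply: (chain_branch_bound (contracted_orbit_proper k0) d2 d2 cD') => u v D2 cD2 vy.
  have [|D20 ufar] := contracted_orbit_avoids k0 (ltW k1) d2 AM kM Ad2 Ac cD2.
    move=> a /yfar ya; have := cmod_tri v y a; rewrite (cmodC y v); lra.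
  by split=> //; exact: ufar.
have kq := Hm _ (ltnW mn); rewrite D'E => h.
have c0 := cmod_ge0 D.
have h1 : cmod D * k ^+ returns n x <= cmod D * (d / 2 * (d / 2) * s / (4 * (X + 1))).
  by rewrite ler_wpM2l // ltW.
have dd : 0 < d / 2 * (d / 2) by rewrite mulr_gt0.
have h2 : cmod D * (d / 2 * (d / 2) * s / (4 * (X + 1))) <= d / 2 * (d / 2) / (4 * (X + 1)).
  have -> : cmod D * (d / 2 * (d / 2) * s / (4 * (X + 1))) =
     (cmod D * s) * (d / 2 * (d / 2) / (4 * (X + 1))) by ring.
  by rewrite ler_piMl // divr_ge0 // ?mulr_ge0 //; lra.
have h3 : (cmod D * k ^+ returns n x) * X <= d / 2 * (d / 2) / (4 * (X + 1)) * X.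
  by rewrite ler_wpM2r // (le_trans h1).
have h4 : d / 2 * (d / 2) / (4 * (X + 1)) * X <= d / 2 * (d / 2) / 4.
  rewrite mulrAC ler_pdivrMr; last by lra.
  have -> : d / 2 * (d / 2) / 4 * (4 * (X + 1)) = d / 2 * (d / 2) * (X + 1) by field.
  by rewrite ler_pM2l //; lra.
by have : d / 2 * (d / 2) <= 2 * (d / 2 * (d / 2) / 4); lra.
Qed.

End AttractingDynamics.

(** * The relaxed Newton map *)


Section Newton.
Variable R : realType.
Local Notation C := R[i].
Implicit Types (x y z u v a c D : C) (P Q : {poly C}) (w : sphere R).

(** Euclidean division gives [P / Q = sg x + tau + r / Q] with [|sg| < 1]. For large [x] each of the
    last two terms is at most [e |x|], and [|sg| + 2 e < 1]. *)
Lemma quotient_repelling P Q : size P = (size Q).+1 -> Q != 0 ->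
  cmod (lead_coef P) < cmod (lead_coef Q) ->
  exists Rb rho : R, [/\ 0 < Rb, 0 <= rho, rho < 1 & forall x, Rb < cmod x ->
    Q.[x] != 0 /\ cmod (P.[x] / Q.[x]) <= rho * cmod x].
Proof.
move=> sP Q0 lPQ.
have lQ : 0 < cmod (lead_coef Q) by rewrite cmod_gt0 lead_coef_eq0.
set sg := lead_coef P / lead_coef Q.
have sg1 : cmod sg < 1 by rewrite /sg cmodM cmodV ltr_pdivrMr // mul1r.
set r := P %% Q; have PE : P = (P %/ Q) * Q + r by exact: divp_eq.
have sr : (size r < size Q)%N by rewrite ltn_modp.
have sQ : (0 < size Q)%N by rewrite size_poly_gt0.
have sL : size (P %/ Q) = 2 by rewrite size_divp // sP -[in X in (X - _)%N](prednK sQ) -addn2 addKn.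
have [tau LE] : exists tau, P %/ Q = sg *: 'X + tau%:P.
  exists (P %/ Q)`_0; apply/polyP => -[|[|i]].
  - by rewrite coefD coefZ coefX mulr0 add0r coefC.
  - rewrite coefD coefZ coefX mulr1 coefC addr0.
    have -> : (P %/ Q)`_1 = lead_coef (P %/ Q).
      by rewrite lead_coefE sL.
    have lL : lead_coef P = lead_coef (P %/ Q) * lead_coef Q.
      have L0 : P %/ Q != 0 by rewrite -size_poly_gt0 sL.
      by rewrite {1}PE lead_coefDl ?lead_coefM // size_mul // sL; exact: leqW sr.
    by rewrite /sg lL mulfK // lead_coef_eq0.
  - by rewrite coefD coefZ coefX coefC mulr0 addr0 nth_default // sL.
pose e := (1 - cmod sg) / 4.
have e0 : 0 < e by rewrite /e; lra.
have sXQ : size ('X * Q) = (size Q).+1 by rewrite mulrC size_mulX.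
(* Where [|r.[x]| > e |x Q.[x]|], one has [x Q.[x] = y r.[x]] with [|y| <= e^-1], so properness of
   ['X * Q / r] confines [x]. The value [y = 0] confines the zeros of [Q]. *)
have [||M HM] := @preimage_bounded _ ('X * Q) r (e^-1).
- by rewrite sXQ (ltn_trans sr).
- by rewrite sXQ ltnS size_poly_gt0.
pose Rb := Num.max 1 (Num.max M (cmod tau / e)).
exists Rb, (cmod sg + e + e); split.
- by rewrite /Rb lt_max ltr01.
- by have := cmod_ge0 sg; lra.
- by rewrite /e; lra.
move=> x; rewrite /Rb !gt_max => /and3P[x1 xM xt].
have Qx : Q.[x] != 0.
  apply/eqP => Qx; have : cmod x <= M.
    apply: (HM x 0); first by rewrite cmod0 invr_ge0 ltW.
    by rewrite hornerM Qx mulr0 mul0r.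
  by rewrite leNgt xM.
split=> //.
have rx : cmod r.[x] <= e * (cmod x * cmod Q.[x]).
  rewrite leNgt; apply/negP => h.
  have r0 : 0 < cmod r.[x].
    by apply: le_lt_trans h; apply: (mulr_ge0 (ltW e0)); rewrite mulr_ge0 ?cmod_ge0.
  have : cmod x <= M.
    apply: (HM x (x * Q.[x] / r.[x])).
      by rewrite cmodM cmodV cmodM ler_pdivrMr // ler_pdivlMl // ltW.
    by rewrite hornerM hornerX divfK // -cmod_gt0.
  by rewrite leNgt xM.
have -> : P.[x] / Q.[x] = sg * x + (tau + r.[x] / Q.[x]).
  have -> : P.[x] = (sg * x + tau) * Q.[x] + r.[x].
    by rewrite [in LHS]PE LE hornerD hornerM hornerD hornerZ hornerX hornerC.
  by clearbody sg r; field.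
have cQ : 0 < cmod Q.[x] by rewrite cmod_gt0.
have t1 : cmod tau <= e * cmod x by rewrite mulrC -ler_pdivrMr // ltW.
have t2 : cmod (r.[x] / Q.[x]) <= e * cmod x.
  by rewrite cmodM cmodV ler_pdivrMr // -mulrA.
apply: le_trans (cmodD _ _) _; rewrite cmodM.
have := cmodD tau (r.[x] / Q.[x]); lra.
Qed.

Section Map.
Variables (p : {poly C}) (h z0 z1 : C).
Hypothesis p0 : p != 0.
Hypothesis z0z1 : z0 != z1.
Hypothesis pz0 : root p z0.
Hypothesis pz1 : root p z1.

Let NP := 'X * p^`() - h *: p.
Let NQ := p^`().
Let g := gcdp NP NQ.
Let P1 := NP %/ g.
Let Q1 := NQ %/ g.
Let f := relaxed_newton h p.

(** The first case is a root with multiplier [1 - h / mup c p = 0]; the second clears denominators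
    in [1 - h + h p p'' / p'^2 = 0]. *)
Definition newton_critical c :=
  (root p c /\ h = (mup c p)%:R) \/
  [/\ ~~ root p c, p^`().[c] != 0 &
      (1 - h) * p^`().[c] ^+ 2 + h * p.[c] * p^`()^`().[c] = 0].

Let NQ0 : NQ != 0.
Proof. by rewrite deriv_neq0 // (root_size_gt1 p0 pz0). Qed.

Let g0 : g != 0.
Proof. by rewrite gcdp_eq0 (negPf NQ0) andbF. Qed.

Let P1E : NP = P1 * g.
Proof. by rewrite divpK // dvdp_gcdl. Qed.

Let Q1E : NQ = Q1 * g.
Proof. by rewrite divpK // dvdp_gcdr. Qed.

Let cop : coprimep P1 Q1.
Proof. by apply: coprimep_div_gcd; rewrite NQ0 orbT. Qed.

Let no_common_zero x : Q1.[x] = 0 -> P1.[x] != 0.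
Proof. by move=> /rootP; apply: coprimep_root; rewrite coprimep_sym. Qed.

(** Values, derivatives and critical points of the reduced fraction can be read off any
    representation whose denominator is nonzero at [x], so the gcd is never computed. *)
Let cross Pt Qt (k : {poly C}) x : k != 0 -> NP = Pt * k -> NQ = Qt * k -> Qt.[x] != 0 ->
  [/\ Q1.[x] != 0, P1.[x] / Q1.[x] = Pt.[x] / Qt.[x] &
    ((wronsk P1 Q1).[x] = 0 -> (wronsk Pt Qt).[x] = 0) /\
    sderiv (fun z => P1.[z] / Q1.[z]) x ((wronsk Pt Qt).[x] / Qt.[x] ^+ 2)].
Proof.
move=> k0 NPE NQE Qtx.
have cr : P1 * Qt = Pt * Q1.
  apply: (mulIf (mulf_neq0 k0 g0)).
  have -> : P1 * Qt * (k * g) = (P1 * g) * (Qt * k) by ring.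
  have -> : Pt * Q1 * (k * g) = (Pt * k) * (Q1 * g) by ring.
  by rewrite -P1E -Q1E -NPE -NQE.
have crx u : P1.[u] * Qt.[u] = Pt.[u] * Q1.[u] by rewrite -!hornerM cr.
have val u : Qt.[u] != 0 -> Q1.[u] != 0 /\ P1.[u] / Q1.[u] = Pt.[u] / Qt.[u].
  move=> Qtu; have Q1u : Q1.[u] != 0.
    apply/eqP => Q1u; have /eqP := crx u; rewrite Q1u mulr0 mulf_eq0 (negPf Qtu) orbF.
    by rewrite (negPf (no_common_zero Q1u)).
  by split=> //; apply/eqP; rewrite eqr_div // crx.
have [Q1x Fx] := val _ Qtx; split=> //.
have sd : sderiv (fun z => P1.[z] / Q1.[z]) x ((wronsk Pt Qt).[x] / Qt.[x] ^+ 2).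
  have [d d0 Hd] := poly_neq0_near Qtx.
  apply: (sderiv_ext d0) (sderiv_quotient Pt Qtx) => u /Hd Qtu.
  by have [_ ->] := val _ Qtu.
split=> // W0; have := sderiv_unique sd (sderiv_quotient P1 Q1x).
rewrite W0 mul0r => /eqP; rewrite mulf_eq0 invr_eq0 expf_eq0 /= (negPf Qtx) orbF.
by move/eqP.
Qed.

Lemma mup_factor z : exists s, p = s * ('X - z%:P) ^+ mup z p /\ s.[z] != 0.
Proof.
have /dvdpP[s ps] : ('X - z%:P) ^+ mup z p %| p by rewrite -mup_geq.
exists s; split=> //; apply/negP => /factor_theorem[s' ss'].
have : ('X - z%:P) ^+ (mup z p).+1 %| p.
  by rewrite {2}ps ss' -mulrA -exprS dvdp_mull.
by rewrite -mup_geq // ltnn.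
Qed.

Let root_local z : root p z ->
  [/\ Q1.[z] != 0, P1.[z] / Q1.[z] = z, (wronsk P1 Q1).[z] = 0 -> h = (mup z p)%:R &
    sderiv (fun x => P1.[x] / Q1.[x]) z (((mup z p)%:R - h) / (mup z p)%:R)].
Proof.
move=> pz; have [s [ps sz]] := mup_factor z.
have : (0 < mup z p)%N by rewrite -XsubC_dvd // dvdp_XsubCl.
move: ps; case E: (mup z p) => [//|m] ps _.
(* Now [m.+1] is the multiplicity. Cancelling [('X - z%:P) ^+ m] from [p'] and from the numerator
   leaves [Qt] and [Pt], and [Qt] does not vanish at [z]. *)
pose Qt := m.+1%:R *: s + ('X - z%:P) * s^`().
pose Pt := 'X * Qt - h *: (('X - z%:P) * s).
have k0 : ('X - z%:P) ^+ m != 0 by rewrite expf_neq0 // polyXsubC_eq0.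
have NQE : NQ = Qt * ('X - z%:P) ^+ m.
  rewrite /NQ ps derivM deriv_exp derivXsubC mul1r /Qt scaler_nat /= exprS.
  rewrite -[_ *+ m.+1]mulr_natl -[s *+ m.+1]mulr_natl.
  by move: (m.+1%:R : {poly C}) => q; ring.
have NPE : NP = Pt * ('X - z%:P) ^+ m.
  rewrite /NP -/NQ NQE /Pt {1}ps exprS -!mul_polyC; ring.
have m0 : m.+1%:R != 0 :> C by rewrite pnatr_eq0.
have Qtz : Qt.[z] = m.+1%:R * s.[z].
  by rewrite /Qt hornerD hornerZ hornerM hornerXsubC subrr mul0r addr0.
have Qtz0 : Qt.[z] != 0 by rewrite Qtz mulf_neq0.
have Ptz : Pt.[z] = z * Qt.[z].
  by rewrite /Pt hornerD hornerN hornerM hornerX hornerZ hornerM hornerXsubC subrr mul0r mulr0 subr0.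
have Wz : (wronsk Pt Qt).[z] = (m.+1%:R - h) * s.[z] * Qt.[z].
  rewrite /wronsk hornerD hornerN !hornerM Ptz.
  have -> : Pt^`().[z] = Qt.[z] + z * Qt^`().[z] - h * s.[z].
    rewrite /Pt derivD derivN derivM derivX derivZ derivM derivXsubC !hornerE; ring.
  by rewrite Qtz; move: (m.+1%:R) => q; ring.
have [Q1z Fz [W0 sd]] := cross k0 NPE NQE Qtz0.
split=> //.
- by rewrite Fz Ptz mulfK.
- move=> /W0 /eqP; rewrite Wz !mulf_eq0 (negPf sz) (negPf Qtz0) !orbF subr_eq0.
  by move=> /eqP ->.
- suff -> : (m.+1%:R - h) / m.+1%:R = (wronsk Pt Qt).[z] / Qt.[z] ^+ 2 by [].
  by rewrite Wz Qtz; move: (m.+1%:R : C) m0 => q q0; field; rewrite sz q0.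
Qed.

Let generic_local z : p^`().[z] != 0 ->
  [/\ Q1.[z] != 0, P1.[z] / Q1.[z] = z - h * p.[z] / p^`().[z] &
    (wronsk P1 Q1).[z] = 0 -> (1 - h) * p^`().[z] ^+ 2 + h * p.[z] * p^`()^`().[z] = 0].
Proof.
move=> p'z.
have [Q1z Fz [W0 _]] := cross (oner_neq0 _) (esym (mulr1 NP)) (esym (mulr1 NQ)) p'z.
split=> //.
  by rewrite Fz /NP /NQ hornerD hornerN hornerM hornerX hornerZ; field.
move=> /W0 <-; rewrite /wronsk /NP /NQ derivD derivN derivM derivX derivZ mul1r.
rewrite !(hornerD, hornerN, hornerM, hornerZ, hornerX); ring.
Qed.

Hypothesis adm : admissible p h.

(** The last clause holds because [p] is divisible by the [mu]-th powers of two coprime linear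
    factors. It excludes [h = deg p], for which the numerator of the map would lose degree. *)
Lemma admissible_bounds : exists mu : nat, [/\ (0 < mu)%N, cmod (h - mu%:R) < mu%:R,
  forall z, root p z -> (mu <= mup z p)%N & (mu + mu < size p)%N].
Proof.
have [mu [_ muP]] := adm.
rewrite -cmodE -(rmorph_nat (@real_complex R)) ltcR rmorph_nat => hmu; exists mu.
have dvd z : root p z -> ('X - z%:P) ^+ mu %| p by move=> /muP; rewrite mup_geq.
split=> //.
  by rewrite -(ltr_nat R); apply: le_lt_trans hmu; exact: cmod_ge0.
have cop01 : coprimep (('X - z0%:P) ^+ mu) (('X - z1%:P) ^+ mu).
  by rewrite coprimep_expl // coprimep_expr // coprimep_XsubC root_XsubC eq_sym.
have : ('X - z0%:P) ^+ mu * ('X - z1%:P) ^+ mu %| p.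
  by rewrite Gauss_dvdp // !dvd.
move=> /(dvdp_leq p0); rewrite size_mul ?expf_neq0 ?polyXsubC_eq0 // !size_exp_XsubC.
by rewrite addnS /= addSn.
Qed.

(** The discs with centre [n] and radius [n] all touch 0 and are nested. *)
Lemma admissible_nat_bound (n mu : nat) : cmod (h - mu%:R) < mu%:R -> (mu <= n)%N ->
  cmod (n%:R - h) < n%:R.
Proof.
move=> hmu mn; have := cmod_tri mu%:R n%:R h; rewrite (cmodC mu%:R h).
have -> : n%:R - mu%:R = (n - mu)%:R :> C by rewrite natrB.
by rewrite cmod_nat natrB //; lra.
Qed.

Let h0 : h != 0.
Proof.
have [mu [_ + _ _]] := admissible_bounds.
by apply: contraTneq => ->; rewrite sub0r cmodN cmod_nat ltxx.
Qed.

Let pole_local z : ~~ root p z -> p^`().[z] = 0 -> Q1.[z] = 0.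
Proof.
move=> pz p'z.
have : P1.[z] * NQ.[z] = NP.[z] * Q1.[z].
  by rewrite -!hornerM {1}Q1E {1}P1E; congr (_.[z]); ring.
rewrite /NQ /NP p'z mulr0 hornerD hornerN hornerM p'z mulr0 sub0r hornerZ => /esym/eqP.
by rewrite !mulf_eq0 oppr_eq0 mulf_eq0 (negPf h0) -rootE (negPf pz) => /eqP.
Qed.

(** With [n.+1] the degree of [p], the leading coefficients of [NP] and [NQ] have ratio
    [(n.+1 - h) / n.+1]; it is nonzero and of modulus below 1. Dividing both by [g] changes neither
    this ratio nor the difference of the degrees. *)
Let sizes : [/\ size P1 = (size Q1).+1, Q1 != 0 & cmod (lead_coef P1) < cmod (lead_coef Q1)].
Proof.
have [mu [mu0 hmu _ szp]] := admissible_bounds.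
have [n sp] : exists n, size p = n.+2.
  have : (1 < size p)%N by apply: leq_ltn_trans szp; rewrite addn_gt0 mu0.
  by case: (size p) => [|[|n]] // _; exists n.
rewrite sp in szp; have lp : lead_coef p = p`_n.+1 by rewrite lead_coefE sp.
have lp0 : p`_n.+1 != 0 by rewrite -lp lead_coef_eq0.
have sNQ : size NQ = n.+1.
  apply/eqP; rewrite eqn_leq -ltnS -sp lt_size_deriv //=.
  have : NQ`_n != 0 by rewrite coef_deriv mulrn_eq0.
  by apply: contraNT; rewrite -leqNgt => sl; rewrite nth_default.
have lNQ : lead_coef NQ = n.+1%:R * p`_n.+1.
  by rewrite lead_coefE sNQ coef_deriv mulr_natl.
have cNP : NP`_n.+1 = (n.+1%:R - h) * p`_n.+1.
  by rewrite coefD coefN coefXM coefZ coef_deriv /= mulrBl mulr_natl.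
have muD : (mu <= n.+1)%N by apply: leq_trans (leq_addr mu mu) _; rewrite -ltnS.
have nh := admissible_nat_bound hmu muD.
have nh0 : n.+1%:R - h != 0.
  apply/eqP => /eqP; rewrite subr_eq0 => /eqP nh0.
  have := cmodB_ge h mu%:R; rewrite -nh0 !cmod_nat; move: hmu; rewrite -nh0.
  move=> i1 i2; have : n.+1%:R < mu%:R + mu%:R :> R by lra.
  by rewrite -natrD ltr_nat ltnNge -ltnS szp.
have sNP : size NP = n.+2.
  apply/eqP; rewrite eqn_leq; apply/andP; split; last first.
    have : NP`_n.+1 != 0 by rewrite cNP mulf_neq0.
    by apply: contraNT; rewrite -leqNgt => sl; rewrite nth_default.
  apply: leq_trans (size_polyD _ _) _; rewrite size_polyN geq_max; apply/andP; split.
    by rewrite mulrC size_mulX // sNQ.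
  by rewrite -sp size_scale_leq.
have lNP : lead_coef NP = (n.+1%:R - h) * p`_n.+1 by rewrite lead_coefE sNP.
have NP0 : NP != 0 by rewrite -size_poly_gt0 sNP.
have P10 : P1 != 0 by apply: contraNneq NP0 => e; rewrite P1E e mul0r.
have Q10 : Q1 != 0 by apply: contraNneq NQ0 => e; rewrite Q1E e mul0r.
split=> //.
  have := sNP; rewrite {1}P1E size_mul // => e1.
  have := sNQ; rewrite {1}Q1E size_mul // => e2.
  have := size_poly_gt0 P1; have := size_poly_gt0 Q1; have := size_poly_gt0 g.
  rewrite g0 P10 Q10; move: (size P1) (size Q1) (size g) e1 e2; clear; lia.
have lg : 0 < cmod (lead_coef g) by rewrite cmod_gt0 lead_coef_eq0.
rewrite -(ltr_pM2r lg) -!cmodM -!lead_coefM -P1E -Q1E lNP lNQ !cmodM cmod_nat.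
by rewrite ltr_pM2r // cmod_gt0.
Qed.

Let proper : proper_pair P1 Q1.
Proof. by have [sP Q10 _] := sizes; split=> //; rewrite sP. Qed.

Let f_finite x : f (Some x) = if Q1.[x] == 0 then None else Some (P1.[x] / Q1.[x]).
Proof. by []. Qed.

Lemma newton_infinity : f None = None.
Proof.
have [sP _ _] := sizes.
by rewrite /f /relaxed_newton /ratmap -/NQ -/NP -/g -/P1 -/Q1 sP ltnSn.
Qed.

Lemma newton_value z : f (Some z) = if root p z then Some z else
  if p^`().[z] == 0 then None else Some (z - h * p.[z] / p^`().[z]).
Proof.
rewrite f_finite; have [pz|pz] := boolP (root p z).
  by have [Q1z -> _ _] := root_local pz; rewrite (negPf Q1z).
have [p'z|p'z] := eqVneq p^`().[z] 0; first by rewrite pole_local // eqxx.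
by have [Q1z -> _] := generic_local p'z; rewrite (negPf Q1z).
Qed.

Let attracting z : root p z -> exists r lam : R,
  [/\ 0 < r, 0 <= lam, lam < 1 & forall x, cmod (x - z) <= r ->
     Q1.[x] != 0 /\ cmod (P1.[x] / Q1.[x] - z) <= lam * cmod (x - z)].
Proof.
move=> pz; have [Q1z Fz _ sd] := root_local pz.
have [mu [mu0 hmu /(_ z pz) mum _]] := admissible_bounds.
have := admissible_nat_bound hmu mum.
have m0 : 0 < (mup z p)%:R :> R by rewrite ltr0n (leq_trans mu0).
set D := _ / _ in sd => nh.
have D1 : cmod D < 1 by rewrite /D cmodM cmodV cmod_nat ltr_pdivrMr // mul1r.
have e0 : 0 < (1 - cmod D) / 2 by lra.
have [d d0 Hd] := sd _ e0.
have [d' d'0 Hd'] := poly_neq0_near Q1z.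
have [d1 [d10 h1 h2]] := min2_gt0 d0 d'0.
exists (d1 / 2), ((1 + cmod D) / 2); split; first by rewrite divr_gt0.
- by have := cmod_ge0 D; lra.
- by lra.
move=> x xr; split; first by apply: Hd'; lra.
have zd : cmod (z - z) < d by rewrite subrr cmod0.
have := Hd x z; rewrite Fz => /(_ ltac:(lra) zd) h3.
have -> : P1.[x] / Q1.[x] - z = (P1.[x] / Q1.[x] - z - D * (x - z)) + D * (x - z) by rewrite subrK.
apply: le_trans (cmodD _ _) _; rewrite cmodM; lra.
Qed.

Let critical_newton c : Q1.[c] != 0 /\ (wronsk P1 Q1).[c] = 0 -> newton_critical c.
Proof.
case=> Q1c W0; have [pc|pc] := boolP (root p c).
  by left; have [_ _ /(_ W0) -> _] := root_local pc.
have p'c : p^`().[c] != 0 by apply: contraNneq Q1c => /(pole_local pc) ->.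
by right; split=> //; have [_ _ /(_ W0)] := generic_local p'c.
Qed.

Lemma newton_basin_critical z : root p z ->
  exists2 c, newton_critical c & basin f z (Some c).
Proof.
move=> pz; have [z' pz' zz'] : exists2 z', root p z' & z != z'.
  by have [->|] := eqVneq z z0; [exists z1|exists z0].
have [c cc bc] := basin_contains_critical proper f_finite newton_infinity attracting pz pz' zz'.
by exists c => //; exact: critical_newton.
Qed.

Lemma newton_basin_unique z z' w : basin f z w -> basin f z' w -> z = z'.
Proof. exact: basin_unique. Qed.

Lemma newton_convergent_critical :
  (forall c, newton_critical c -> exists2 z, root p z & basin f z (Some c)) ->
  newton_convergent p h.
Proof.
move=> H; have [sP Q10 lPQ] := sizes.
have [Rb [rho [Rb0 rho0 rho1 rep]]] := quotient_repelling sP Q10 lPQ.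
move=> w; split=> [fw|[z pz bz]].
  apply: (fatou_basin proper f_finite newton_infinity Rb0 rho0 rho1 rep attracting pz0 _ fw).
  by move=> c /critical_newton /H.
exact: (basin_fatou f_finite newton_infinity attracting pz bz).
Qed.

End Map.
End Newton.

(** * The three classes *)


Section Classes.
Variable R : realType.
Local Notation C := R[i].
Implicit Types (x y z u v c h : C) (p : {poly C}).

Lemma quadratic_third_root (al be ga x y z : C) : al != 0 ->
  al * x ^+ 2 + be * x + ga = 0 -> al * y ^+ 2 + be * y + ga = 0 ->
  al * z ^+ 2 + be * z + ga = 0 -> x != y -> z = x \/ z = y.
Proof.
move=> al0 ex ey ez xy.
have [->|zx] := eqVneq z x; [by left | right].
have dif a b : al * a ^+ 2 + be * a + ga = 0 -> al * b ^+ 2 + be * b + ga = 0 ->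
    a != b -> al * (a + b) + be = 0.
  move=> ea eb ab; apply/eqP.
  have : (a - b) * (al * (a + b) + be) = 0.
    have -> : (a - b) * (al * (a + b) + be) =
      (al * a ^+ 2 + be * a + ga) - (al * b ^+ 2 + be * b + ga) by ring.
    by rewrite ea eb subrr.
  by move/eqP; rewrite mulf_eq0 subr_eq0 (negPf ab).
have e1 := dif _ _ ey ex (_ : y != x); have e2 := dif _ _ ez ex zx.
have : al * (z - y) = 0.
  have -> : al * (z - y) = (al * (z + x) + be) - (al * (y + x) + be) by ring.
  by rewrite e1 ?e2 ?subrr // eq_sym.
by move/eqP; rewrite mulf_eq0 (negPf al0) subr_eq0 => /eqP.
Qed.

(** Multiplying by [q] restores the exponent [k] and so covers [k = 0]. *)
Lemma deriv_exprM (q : {poly C}) k : (q ^+ k)^`() * q = k%:R *: (q^`() * q ^+ k).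
Proof.
rewrite deriv_exp; case: k => [|k]; first by rewrite mulr0n mul0r scale0r.
by rewrite scaler_nat mulrnAl -mulrA -exprSr.
Qed.

Lemma admissible_neq_nat h (mu n : nat) : cmod (h - mu%:R) < mu%:R -> (mu + mu <= n)%N ->
  n%:R - h != 0.
Proof.
move=> hmu mun; apply: contraTneq hmu => /eqP; rewrite subr_eq0 => /eqP <-.
have mn : (mu <= n)%N := leq_trans (leq_addr _ _) mun.
by rewrite -natrB // cmod_nat ltr_nat -leqNgt leq_subRL.
Qed.

Lemma two_roots_factor p a b : p != 0 -> a != b ->
  (forall z, root p z = (z == a) || (z == b)) ->
  exists e : C, p = e%:P * ('X - b%:P) ^+ mup b p * ('X - a%:P) ^+ mup a p.
Proof.
move=> p0 ab rp; have [s [ps sa]] := mup_factor p0 a.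
have s0 : s != 0 by apply: contraNneq sa => ->; rewrite horner0.
have [t [st tb]] := mup_factor s0 b.
have mb : mup b p = mup b s.
  rewrite [in LHS]ps mupMl // rootE horner_exp hornerXsubC expf_neq0 //.
  by rewrite subr_eq0 eq_sym.
have /size_poly1P[e _ te] : size t == 1.
  apply: contraT => /closed_rootP[x tx].
  have : root p x by rewrite ps st !rootM tx.
  rewrite rp => /orP[]/eqP xE; move: tx; rewrite xE => /rootP tx.
    by move: sa; rewrite st hornerM tx mul0r eqxx.
  by move: tb; rewrite tx eqxx.
by exists e; rewrite mb -te -st.
Qed.

(** With [A = c - a], [B = c - b] and [p' / p = k / A + l / B], the critical equation becomes
    [(k B + l A)^2 = h (k B^2 + l A^2)], expanded here in powers of [c]. A root whose multiplicity
    is [h] also satisfies it. *)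
Lemma two_roots_critical p a b h c (k l : C) : p != 0 -> a != b ->
  (forall z, root p z = (z == a) || (z == b)) ->
  k = (mup a p)%:R -> l = (mup b p)%:R -> newton_critical p h c ->
  ((k + l) ^+ 2 - h * (k + l)) * c ^+ 2
   + (2 * h * (k * b + l * a) - 2 * (k + l) * (k * b + l * a)) * c
   + ((k * b + l * a) ^+ 2 - h * (k * b ^+ 2 + l * a ^+ 2)) = 0.
Proof.
move=> p0 ab rp kE lE cr.
have [e pe] := two_roots_factor p0 ab rp.
case: cr => [[]|[]].
  rewrite rp => /orP[]/eqP -> hE.
    have {hE} -> : h = k by exact: etrans hE (esym kE).
    by clear; ring.
  have {hE} -> : h = l by exact: etrans hE (esym lE).
  by clear; ring.
rewrite rp negb_or => /andP[ca cb] p'c E.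
have A0 : c - a != 0 by rewrite subr_eq0.
have B0 : c - b != 0 by rewrite subr_eq0.
pose L := k *: ('X - b%:P) + l *: ('X - a%:P).
have id1 : p^`() * (('X - a%:P) * ('X - b%:P)) = p * L.
  rewrite pe /L kE lE; move: (mup a p) (mup b p) => i j; clear.
  rewrite !derivM derivC mul0r add0r.
  have -> : (e%:P * (('X - b%:P) ^+ j)^`() * ('X - a%:P) ^+ i +
      e%:P * ('X - b%:P) ^+ j * (('X - a%:P) ^+ i)^`()) * (('X - a%:P) * ('X - b%:P)) =
    e%:P * ((('X - b%:P) ^+ j)^`() * ('X - b%:P)) * ('X - a%:P) ^+ i * ('X - a%:P) +
    e%:P * ('X - b%:P) ^+ j * ((('X - a%:P) ^+ i)^`() * ('X - a%:P)) * ('X - b%:P) by ring.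
  rewrite !deriv_exprM !derivXsubC -!mul_polyC.
  by move: (polyC i%:R) (polyC j%:R) => q1 q2; ring.
have e1 : p^`().[c] * ((c - a) * (c - b)) = p.[c] * (k * (c - b) + l * (c - a)).
  have := congr1 (fun q : {poly C} => q.[c]) id1.
  by rewrite /= /L !(hornerXsubC, hornerM, hornerZ, hornerD).
have e2 : p^`()^`().[c] * ((c - a) * (c - b)) + p^`().[c] * ((c - b) + (c - a)) =
    p^`().[c] * (k * (c - b) + l * (c - a)) + p.[c] * (k + l).
  have := congr1 (fun q : {poly C} => q^`().[c]) id1.
  rewrite /= /L !(derivXsubC, derivM, derivZ, derivD).
  by rewrite !(mul1r, mulr1, hornerXsubC, hornerC, hornerM, hornerZ, hornerD).
have pc0 : p.[c] != 0 by rewrite -rootE rp negb_or ca cb.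
have [A AE] : exists A, A = c - a by exists (c - a).
have [B BE] : exists B, B = c - b by exists (c - b).
rewrite -AE -BE in A0 B0 e1 e2.
have p'E : p^`().[c] = p.[c] * (k * B + l * A) / (A * B).
  by rewrite -e1 mulfK // mulf_neq0.
have p''E : p^`()^`().[c] = (p^`().[c] * (k * B + l * A) + p.[c] * (k + l)
     - p^`().[c] * (B + A)) / (A * B).
  by rewrite -e2 addrK mulfK // mulf_neq0.
have : p.[c] ^+ 2 * ((k * B + l * A) ^+ 2 - h * (k * B ^+ 2 + l * A ^+ 2)) = 0.
  have -> : p.[c] ^+ 2 * ((k * B + l * A) ^+ 2 - h * (k * B ^+ 2 + l * A ^+ 2)) =
    ((1 - h) * p^`().[c] ^+ 2 + h * p.[c] * p^`()^`().[c]) * (A * B) ^+ 2.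
    by rewrite p''E p'E; field; rewrite A0 B0.
  by rewrite E mul0r.
move/eqP; rewrite mulf_eq0 expf_eq0 /= (negPf pc0) /= => /eqP <-.
rewrite AE BE; ring.
Qed.

Lemma two_roots_h_convergent p : two_roots p -> h_convergent p.
Proof.
case=> p0 [a [b [ab rp]]] h adm.
have pa : root p a by rewrite rp eqxx.
have pb : root p b by rewrite rp eqxx orbT.
have [mu [mu0 hmu mule _]] := admissible_bounds p0 ab pa pb adm.
have [c0 cr0 b0] := newton_basin_critical p0 ab pa pb adm pa.
have [c1 cr1 b1] := newton_basin_critical p0 ab pa pb adm pb.
have c01 : c0 != c1.
  apply: contraNneq ab => cc; rewrite -cc in b1.
  by apply/eqP; exact: newton_basin_unique b0 b1.
(* The leading coefficient of the quadratic is [(k + l) (k + l - h)]. As it is nonzero, the critical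
   points [c0] and [c1] found in the two disjoint basins are its only roots. *)
have Dh : (mup a p)%:R + (mup b p)%:R - h != 0.
  by rewrite -natrD; apply: admissible_neq_nat hmu _; rewrite leq_add // mule.
have D0 : (mup a p)%:R + (mup b p)%:R != 0 :> C.
  rewrite -natrD pnatr_eq0 -lt0n; exact: ltn_addr (leq_trans mu0 (mule _ pa)).
apply: (newton_convergent_critical p0 ab pa pb adm) => c cr.
have [|->|->] := quadratic_third_root _ (two_roots_critical p0 ab rp erefl erefl cr0)
   (two_roots_critical p0 ab rp erefl erefl cr1) (two_roots_critical p0 ab rp erefl erefl cr) c01.
- by rewrite expr2 [h * _]mulrC -mulrBr mulf_neq0.
- by exists a.
- by exists b.
Qed.

(** * Shifted binomials times a power, with [m = 0] giving the unicritical class *)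

Section ClassIII.
Variables (a b c : C) (m n : nat).
Hypothesis a0 : a != 0.
Hypothesis c0 : c != 0.
Hypothesis n2 : (2 <= n)%N.
Let W : {poly C} := a *: 'X + b%:P.
Let p : {poly C} := W ^+ m * (W ^+ n + c%:P).
Let w z := a * z + b.
Let D : C := (m + n)%:R.

Let n0 : (0 < n)%N. Proof. exact: ltnW. Qed.

Let WE z : W.[z] = w z.
Proof. by rewrite /W hornerD hornerZ hornerX hornerC. Qed.

Let pE z : p.[z] = w z ^+ m * (w z ^+ n + c).
Proof. by rewrite /p hornerM hornerD !horner_exp hornerC WE. Qed.

Let wsurj y : exists z, w z = y.
Proof. by exists ((y - b) / a); rewrite /w mulrC divfK // subrK. Qed.

Let winj z z' : w z = w z' -> z = z'.
Proof. by move=> /addIr /(mulfI a0). Qed.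

Let p0 : p != 0.
Proof.
have [z zE] := wsurj 0; have [z' z'E] := wsurj 1.
rewrite /p mulf_neq0 ?expf_neq0 //; apply/eqP.
  by move=> /(congr1 (fun q : {poly C} => q.[z'])) /eqP; rewrite /= WE z'E horner0 oner_eq0.
move=> /(congr1 (fun q : {poly C} => q.[z])) /eqP.
by rewrite /= hornerD horner_exp WE zE expr0n gtn_eqF // add0r hornerC horner0 (negPf c0).
Qed.

Let rootE' z : root p z = (w z == 0) && (0 < m)%N || (w z ^+ n == - c).
Proof. by rewrite rootE pE mulf_eq0 expf_eq0 [w z ^+ n + c == 0]addr_eq0 [(0 < m)%N && _]andbC. Qed.

Let W' : W^`() = a%:P.
Proof. by rewrite /W derivD derivZ derivX derivC addr0 alg_polyC. Qed.

Let WX k : W * (W ^+ k)^`() = (k%:R * a) *: W ^+ k.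
Proof. by rewrite mulrC deriv_exprM W' mul_polyC scalerA. Qed.

(** The factor [W] avoids the exponent [m - 1], so the case [m = 0] is included. *)
Let Wp' : W * p^`() = a *: (D *: W ^+ (m + n) + (m%:R * c) *: W ^+ m).
Proof.
have -> : p = W ^+ (m + n) + c *: W ^+ m by rewrite /p mulrDr -exprD -mul_polyC [c%:P * _]mulrC.
by rewrite derivD derivZ mulrDr -scalerAr !WX scalerDr !scalerA /D;
  congr (_ *: _ + _ *: _); ring.
Qed.

Let WWp'' : W ^+ 2 * p^`()^`() = a ^+ 2 *: ((D * (D - 1)) *: W ^+ (m + n)
   + (m%:R * (m%:R - 1) * c) *: W ^+ m).
Proof.
have := congr1 (fun q => W * q^`()) Wp'.
rewrite /= derivM W' derivZ derivD !derivZ => E.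
have -> : W ^+ 2 * p^`()^`() = W * (a%:P * p^`() + W * p^`()^`()) - a *: (W * p^`()).
  by rewrite -mul_polyC; ring.
rewrite E Wp' -scalerAr mulrDr -!scalerAr !WX /D -!mul_polyC !polyCM !polyCB.
by ring.
Qed.

Let p'E z : w z * p^`().[z] = a * w z ^+ m * (D * w z ^+ n + m%:R * c).
Proof.
have := congr1 (fun q : {poly C} => q.[z]) Wp'.
rewrite /= hornerM WE !(hornerZ, hornerD) !horner_exp WE => ->; rewrite exprD; ring.
Qed.

Let p''E z : w z ^+ 2 * p^`()^`().[z] =
  a ^+ 2 * w z ^+ m * (D * (D - 1) * w z ^+ n + m%:R * (m%:R - 1) * c).
Proof.
have := congr1 (fun q : {poly C} => q.[z]) WWp''.
rewrite /= hornerM !(hornerZ, hornerD) !horner_exp WE => ->; rewrite exprD; ring.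
Qed.

Let mup_simple z : w z ^+ n = - c -> mup z p = 1%N.
Proof.
move=> wz; have w0 : w z != 0.
  by apply: contraNneq c0 => e; move: wz; rewrite e expr0n gtn_eqF // => /esym/eqP; rewrite oppr_eq0.
have p'0 : p^`().[z] != 0.
  apply/eqP => p'0; have := p'E z; rewrite p'0 mulr0 wz => /esym/eqP.
  have -> : D * - c + m%:R * c = - (n%:R * c) by rewrite /D natrD; ring.
  by rewrite !mulf_eq0 oppr_eq0 mulf_eq0 expf_eq0 (negPf a0) (negPf w0) (negPf c0) pnatr_eq0 gtn_eqF // andbF.
have pz : root p z by rewrite rootE' wz eqxx orbT.
have [s [ps _]] := mup_factor p0 z.
have : (0 < mup z p)%N by rewrite -XsubC_dvd // dvdp_XsubCl.
move: ps; case: (mup z p) => [|[|k]] // ps _.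
move: p'0; rewrite [p in p^`()]ps derivM deriv_exp derivXsubC mul1r /= hornerD !hornerM.
by rewrite hornerMn !horner_exp hornerXsubC subrr !expr0n /= mul0rn !mulr0 addr0 eqxx.
Qed.

Let mup_zero z : w z = 0 -> mup z p = m.
Proof.
move=> wz; have WX' : W = a%:P * ('X - z%:P).
  have bE : b = - (a * z) by apply/eqP; rewrite -addr_eq0 addrC; apply/eqP.
  by rewrite /W bE -mul_polyC polyCN polyCM; ring.
rewrite /p mupMl; last first.
  by rewrite rootE hornerD horner_exp WE wz expr0n gtn_eqF // add0r hornerC.
rewrite WX' exprMn mupMr ?mup_XsubCX ?eqxx //.
by rewrite rootE horner_exp hornerC expf_neq0.
Qed.

(** For [m = 0] the zero of [w] is a zero of [p'], since [n >= 2], but not of [p]: it is a pole, and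
    the root 0 of the equation in [w z ^+ n] below is spurious. *)
Let critical_power_neq0 h z : newton_critical p h z -> m = 0%N -> w z != 0.
Proof.
case=> [[pz _]|[_ p'z _]] m00; apply/eqP => wz.
  move: pz; rewrite rootE' wz m00 ltnn andbF expr0n gtn_eqF //= => /eqP/esym/eqP.
  by rewrite oppr_eq0 (negPf c0).
move: p'z; rewrite /p m00 expr0 mul1r derivD derivC addr0 deriv_exp hornerMn hornerM horner_exp WE wz.
by rewrite expr0n -subn1 subn_eq0 leqNgt n2 mulr0 mul0rn eqxx.
Qed.

(** In terms of [u = w z ^+ n], the polynomials [p], [w p'] and [w^2 p''] are [w^m] times affine
    functions of [u]. Multiplying the critical equation by [w^2] and dividing by [a^2 w^(2m)] leaves
    a quadratic in [u]. *)
Lemma class_iii_critical h z : newton_critical p h z ->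
  (D ^+ 2 - h * D) * (w z ^+ n) ^+ 2
  + (2 * (1 - h) * D * m%:R * c + h * (D * (D - 1) * c + m%:R * (m%:R - 1) * c)) * w z ^+ n
  + (m%:R * (m%:R - h) * c ^+ 2) = 0.
Proof.
move=> cr; set u := w z ^+ n.
suff : (1 - h) * (D * u + m%:R * c) ^+ 2 + h * (u + c) * (D * (D - 1) * u + m%:R * (m%:R - 1) * c) = 0.
  by move=> <-; ring.
case: (cr) => [[pz hE]|[pz p'z E]].
  move: pz; rewrite rootE' => /orP[/andP[/eqP wz m0]|/eqP wz].
    have -> : u = 0 by rewrite /u wz expr0n gtn_eqF.
    by rewrite hE mup_zero //; ring.
  have -> : h = 1 by rewrite hE mup_simple.
  by rewrite /u wz subrr mul0r add0r addNr mulr0 mul0r.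
have w0 : w z != 0.
  have [m00|m0] := posnP m; first exact: critical_power_neq0 cr m00.
  by apply: contraNneq pz => wz; rewrite rootE' wz eqxx m0.
have : a ^+ 2 * (w z ^+ m) ^+ 2 * ((1 - h) * (D * u + m%:R * c) ^+ 2
    + h * (u + c) * (D * (D - 1) * u + m%:R * (m%:R - 1) * c)) = 0.
  have -> : a ^+ 2 * (w z ^+ m) ^+ 2 * ((1 - h) * (D * u + m%:R * c) ^+ 2
    + h * (u + c) * (D * (D - 1) * u + m%:R * (m%:R - 1) * c)) =
    (1 - h) * (a * w z ^+ m * (D * u + m%:R * c)) ^+ 2 + h * (w z ^+ m * (u + c)) *
     (a ^+ 2 * w z ^+ m * (D * (D - 1) * u + m%:R * (m%:R - 1) * c)) by ring.
  rewrite -p'E -p''E -pE.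
  have -> : (1 - h) * (w z * p^`().[z]) ^+ 2 + h * p.[z] * (w z ^+ 2 * p^`()^`().[z]) =
    w z ^+ 2 * ((1 - h) * p^`().[z] ^+ 2 + h * p.[z] * p^`()^`().[z]) by ring.
  by rewrite E mulr0.
by move/eqP; rewrite !mulf_eq0 !expf_eq0 /= (negPf a0) (negPf w0) andbF /= => /eqP.
Qed.

(** * Symmetry of the map under rotations about the zero of [w] *)

Section Rotation.
Variables (h z0 z1 om : C).
Hypothesis z01 : z0 != z1.
Hypothesis pz0 : root p z0.
Hypothesis pz1 : root p z1.
Hypothesis adm : admissible p h.
Hypothesis omn : om ^+ n = 1.
Let f := relaxed_newton h p.
Let T z := om * z + (om - 1) * b / a.

Lemma rotation_affine z : w (T z) = om * w z.
Proof. by rewrite /w /T; field. Qed.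

Let om0 : om != 0.
Proof. by apply: contraTneq (oner_neq0 C) => e; rewrite -omn e expr0n gtn_eqF // eqxx. Qed.

Lemma rotation_root z : root p (T z) = root p z.
Proof. by rewrite !rootE' rotation_affine exprMn omn mul1r mulf_eq0 (negPf om0). Qed.

Let pT z : p.[T z] = om ^+ m * p.[z].
Proof. by rewrite !pE rotation_affine !exprMn omn mul1r mulrA. Qed.

Let p'T z : om * p^`().[T z] = om ^+ m * p^`().[z].
Proof.
have sT : sderiv T z om.
  have -> : om = (0 * z + om * 1) + 0 by ring.
  exact: sderivD (sderivM (sderiv_const _ _) (sderiv_id _)) (sderiv_const _ _).
have s1 := sderiv_comp sT (sderiv_poly p (T z)).
have s2 := sderivM (sderiv_const (om ^+ m) z) (sderiv_poly p z).
rewrite mul0r add0r in s2; rewrite mulrC.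
apply: (sderiv_unique s1); apply: (sderiv_ext ltr01) s2 => u _ /=.
by rewrite pT.
Qed.

Lemma rotation_newton z : f (Some (T z)) = omap T (f (Some z)).
Proof.
rewrite /f !(newton_value p0 z01 pz0 pz1 adm) rotation_root.
case: ifP => // _.
have p'0 : (p^`().[T z] == 0) = (p^`().[z] == 0).
  by rewrite -(mulrI_eq0 _ (mulfI om0)) p'T mulf_eq0 expf_eq0 (negPf om0) andbF.
rewrite p'0; case: eqP => // /eqP p'z; congr Some.
have p'Tz : p^`().[T z] != 0 by rewrite p'0.
have -> : p^`().[T z] = om ^+ m * p^`().[z] / om by rewrite -p'T mulrC mulKf.
have : om ^+ m != 0 by rewrite expf_neq0.
by rewrite pT /T; move: (om ^+ m) => q q0; field; rewrite a0 p'z q0 om0.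
Qed.

Lemma rotation_basin z x : basin f z (Some x) -> basin f (T z) (Some (T x)).
Proof.
move=> bz e e0; have K0 : 0 <= 2 * cmod om + 1 by have := cmod_ge0 om; lra.
have e2 : 0 < e / 2 by lra.
have [d [d0 _ dK]] := small_factor K0 e2.
have [K HK] := basin_near_eventually bz d0; exists K => k /HK[y yE yz].
have -> : iter k f (Some (T x)) = Some (T y).
  suff -> : iter k f (Some (T x)) = omap T (iter k f (Some x)) by rewrite yE.
  elim: k {yE} => // k IH; rewrite !iterS IH.
  case: (iter k f (Some x)) => [v|]; first exact: rotation_newton.
  change (f None = omap T (f None)); by rewrite /f (newton_infinity p0 z01 pz0 pz1 adm).
apply: le_lt_trans (chord_le _ _) _.
have -> : T y - T z = om * (y - z) by rewrite /T; ring.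
rewrite cmodM.
have : cmod om * cmod (y - z) <= cmod om * d by rewrite ler_wpM2l ?cmod_ge0 // ltW.
have : d * (2 * cmod om + 1) <= e / 2 by [].
lra.
Qed.

End Rotation.

(** Points with equal [n]-th powers of [w] differ by a rotation, which permutes the basins. The last
    clause records that the zero of [w] is fixed by all rotations, which tells its basin from the
    others. *)
Let same_power h z0 z1 z x x' : z0 != z1 -> root p z0 -> root p z1 -> admissible p h ->
  w x ^+ n = w x' ^+ n -> root p z -> basin (relaxed_newton h p) z (Some x) ->
  exists2 z', root p z' & basin (relaxed_newton h p) z' (Some x') /\ (w z = 0 -> z' = z).
Proof.
move=> z01 pz0 pz1 adm xx pz bx.
have [om omn omx] : exists2 om, om ^+ n = 1 & w x' = om * w x.
  have [wx|wx] := eqVneq (w x) 0.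
    exists 1; rewrite ?expr1n // wx mulr0; apply/eqP.
    by move/eqP: xx; rewrite wx expr0n gtn_eqF // eq_sym expf_eq0 n0.
  exists (w x' / w x); last by rewrite divfK.
  by rewrite expr_div_n xx divff // -xx expf_neq0.
exists (om * z + (om - 1) * b / a); first by rewrite rotation_root.
split.
  have -> : x' = om * x + (om - 1) * b / a by apply: winj; rewrite rotation_affine.
  exact: rotation_basin z01 pz0 pz1 adm omn _ _ bx.
by move=> wz; apply: winj; rewrite rotation_affine wz mulr0.
Qed.

Lemma shifted_binomial_h_convergent : h_convergent p.
Proof.
move=> h adm.
(* A root of [1 + X + ... + X^(n-1)]. It rotates [z1] to a second root [z2], so that [p] has two
   distinct roots even when [m = 0]. *)
have [om omn om1] : exists2 om : C, om ^+ n = 1 & om != 1.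
  have [|om rom] := closed_rootP (\poly_(i < n) 1 : {poly C}) _.
    by rewrite size_poly_eq ?oner_eq0 // gtn_eqF.
  have sum0 : \sum_(i < n) om ^+ i = 0.
    by move/rootP: rom; rewrite horner_poly => {2}<-; apply: eq_bigr => i _; rewrite mul1r.
  exists om; first by apply/eqP; rewrite -subr_eq0 subrX1 sum0 mulr0.
  apply: contra_eq_neq sum0 => ->.
  by under eq_bigr do rewrite expr1n; rewrite sumr_const card_ord pnatr_eq0 gtn_eqF.
have [z1 z1E] := wsurj (n.-root (- c)).
have w1 : w z1 ^+ n = - c by rewrite z1E rootCK.
have w10 : w z1 != 0.
  by apply: contraNneq c0 => e; move: w1; rewrite e expr0n gtn_eqF // => /esym/eqP; rewrite oppr_eq0.
have pz1 : root p z1 by rewrite rootE' w1 eqxx orbT.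
pose z2 := om * z1 + (om - 1) * b / a.
have pz2 : root p z2 by rewrite rotation_root.
have z12 : z1 != z2.
  apply: contraNneq om1 => e; have := rotation_affine om z1; rewrite -/z2 -e.
  by rewrite -{1}[w z1]mul1r => /(mulIf w10) <-.
have [mu [mu0 hmu mule _]] := admissible_bounds p0 z12 pz1 pz2 adm.
have Dh : D - h != 0.
  apply: admissible_neq_nat hmu _; have := mule _ pz1; rewrite mup_simple // => mu1.
  by apply: leq_trans (leq_addl _ _); apply: leq_trans n2; rewrite (leq_add mu1 mu1).
have D0 : D != 0 by rewrite pnatr_eq0 -lt0n addn_gt0 n0 orbT.
have al0 : D ^+ 2 - h * D != 0 by rewrite expr2 -mulrBl mulf_neq0.
have [c1 cr1 b1] := newton_basin_critical p0 z12 pz1 pz2 adm pz1.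
apply: (newton_convergent_critical p0 z12 pz1 pz2 adm) => x cr.
have sp := same_power z12 pz1 pz2 adm.
have [m00|m0] := posnP m.
  have [|z' pz' [bz' _]] := sp _ c1 x _ pz1 b1; last by exists z'.
  (* The constant term of the quadratic vanishes with [m], and [w y] is nonzero, so a linear
     equation determines [w y ^+ n]: all critical points are rotations of [c1]. *)
  have lin y : newton_critical p h y -> (D ^+ 2 - h * D) * w y ^+ n
     + (2 * (1 - h) * D * m%:R * c + h * (D * (D - 1) * c + m%:R * (m%:R - 1) * c)) = 0.
    move=> cry; have := class_iii_critical cry; have := critical_power_neq0 cry m00.
    have -> : m%:R * (m%:R - h) * c ^+ 2 = 0 by rewrite m00 mulr0n !mul0r.
    rewrite addr0 expr2 mulrA -mulrDl => wy /eqP.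
    by rewrite mulf_eq0 expf_eq0 (negPf wy) andbF orbF => /eqP.
  apply: (mulfI al0); apply: (@addIr _ (2 * (1 - h) * D * m%:R * c + h * (D * (D - 1) * c + m%:R * (m%:R - 1) * c))).
  by rewrite !lin.
have [z0 w0] := wsurj 0.
have pz0 : root p z0 by rewrite rootE' w0 eqxx m0.
have [x0 cr0 b0] := newton_basin_critical p0 z12 pz1 pz2 adm pz0.
(* Equal powers would put [c1] in the basin of [z0], the fixed point of the rotations, whereas it
   lies in that of [z1]. *)
have u01 : w x0 ^+ n != w c1 ^+ n.
  apply/eqP => e; have [z' _ [bz' /(_ w0) zE]] := sp _ _ _ e pz0 b0.
  have := newton_basin_unique b1 bz'; rewrite zE => e'.
  by move: w10; rewrite e' w0 eqxx.
have [e|e] := quadratic_third_root al0 (class_iii_critical cr0) (class_iii_critical cr1)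
    (class_iii_critical cr) u01.
  by have [z' pz' [bz' _]] := sp _ _ _ (esym e) pz0 b0; exists z'.
by have [z' pz' [bz' _]] := sp _ _ _ (esym e) pz1 b1; exists z'.
Qed.

End ClassIII.

Lemma class_iii_h_convergent p : class_iii p -> h_convergent p.
Proof. by case=> a [b [c [m [n [a0 c0 n2 ->]]]]]; exact: shifted_binomial_h_convergent. Qed.

Lemma unicritical_class_iii p : unicritical p -> class_iii p.
Proof.
case=> al [be [n [be0 n2 ->]]]; exists 1, (- al), be, 0%N, n; split=> //.
  exact: oner_neq0.
by rewrite expr0 mul1r scale1r polyCN.
Qed.

End Classes.

Theorem theoremA (R : realType) (p : {poly R[i]}) :
  two_roots p \/ unicritical p \/ class_iii p -> h_convergent p.
Proof.
case=> [|[/unicritical_class_iii|]]; first exact: two_roots_h_convergent.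
  exact: class_iii_h_convergent.
exact: class_iii_h_convergent.
Qed.
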